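(* Let $d\ge3$, $\beta>0$, $K\ge1$. There exists a constant $c>0$ depending only on $d,\beta,K$ such that for every integer $n\ge1$, $$\inf_{\widehat p_n}\ \sup_{p^\star\in\mathcal A^\beta_K}\ \mathbb E_{X^{(i)}\sim p^\star}\big[\mathrm W_1(p^\star,\widehat p_n)\big]\ \ge\ c\,n^{-\frac{\beta+1}{2\beta+d}},$$ where $(X^{(1)},\dots,X^{(n)})$ is an i.i.d. sample drawn from $p^\star$ and $\widehat p_n$ ranges among all the estimators of $p^\star$ based on $(X^{(1)},\dots,X^{(n)})$.
   Context: **Hölder norms.** For $\eta\ge0$ let $\lfloor\eta\rfloor=\max\{k\in\mathbb N_0: k\le\eta\}$. For $f=(f_1,\dots,f_p):\mathcal X\subset\mathbb R^q\to\mathbb R^p$ of class $\mathcal C^{\lfloor\eta\rfloor}$ set $\|f\|_{\mathcal H^\eta}=\max_{j}\{\sum_{0\le|\nu|\le\lfloor\eta\rfloor}\|\partial^\nu f_j\|_{L^\infty(\mathcal X)}+\sum_{|\nu|=\lfloor\eta\rfloor}\|\partial^\nu f_j\|_{\eta-\lfloor\eta\rfloor}\}$, where $\|g\|_\alpha=\sup_{x\ne y}|g(x)-g(y)|/\|x-y\|^\alpha$. $\mathcal H^\eta_K(\mathcal X)$ is the set of $f$ with $\|f\|_{\mathcal H^\eta}\le K$. **Statistical model.** $\mathcal A^\beta_K$ is the set of probability densities $p^\star:\mathbb R^d\to\mathbb R_+$ that can be written $p^\star(x)=\exp(-u(x)+a(x))$ with $u:\mathbb R^d\to\mathbb R\cup\{\infty\}$,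 $a:\mathbb R^d\to\mathbb R$ such that: (1) $a\in\mathcal H^\beta_K(\mathrm{Support}(p^\star))$ and $u\in\mathcal C^{1+\max\{1,\lfloor\beta\rfloor\}}(\mathrm{Support}(p^\star))$; (2) $\nabla^2u\succeq K^{-1}I_{d\times d}$; (3) $\|\arg\min u\|\le K$; (4) for all $x,y\in\mathbb R^d$ with $\|x-y\|\le(K\{1\vee|u(x)|\})^{-K}$ and all $k\in\{0,\dots,\lfloor\beta\rfloor+1\}$, $\|\nabla^ku(y)\|\le K(1+|u(x)|^K)$. $\mathrm W_1$ is the $1$-Wasserstein distance; distributions are identified with their densities. *)

(* Defs.v *)
From HB Require Import structures.
From mathcomp Require Import all_boot all_order all_algebra.
From mathcomp Require Import all_classical all_reals all_analysis.

Set Implicit Arguments.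
Unset Strict Implicit.
Unset Printing Implicit Defensive.

Import Order.TTheory GRing.Theory Num.Theory.
Import numFieldNormedType.Exports.

Local Open Scope classical_set_scope.
Local Open Scope ring_scope.

Definition measure_rV_display : measure_display -> measure_display.
Proof. exact. Qed.

(* 'rV[T]_n carries the product sigma-algebra generated by the coordinates;
   for T = R this is the Borel sigma-algebra of R^n. *)
Section measurable_rV.
Context {disp : measure_display} {T : measurableType disp}.
Variable n : nat.

Let coord (i : 'I_n) (x : 'rV[T]_n) : T := x ord0 i.

Let rV_set0 : g_sigma_preimage coord set0.
Proof. exact: sigma_algebra0. Qed.

Let rV_setC A : g_sigma_preimage coord A -> g_sigma_preimage coord (~` A).
Proof. exact: sigma_algebraC. Qed.

Let rV_bigcup (F : (set 'rV[T]_n)^nat) :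
  (forall i, g_sigma_preimage coord (F i)) ->
  g_sigma_preimage coord (\bigcup_i (F i)).
Proof. exact: sigma_algebra_bigcup. Qed.

HB.instance Definition _ := @isMeasurable.Build (measure_rV_display disp)
  'rV[T]_n (g_sigma_preimage coord) rV_set0 rV_setC rV_bigcup.

End measurable_rV.

Definition row_of_tuple (T : Type) (n : nat) (t : n.-tuple T) : 'rV[T]_n :=
  \row_i tnth t i.

Lemma measurable_row_of_tuple disp (T : measurableType disp) n :
  measurable_fun [set: n.-tuple T] (@row_of_tuple T n).
Proof.
apply: (@measurability _ _ _ _ _ _
  (\big[setU/set0]_(i < n) preimage_set_system setT
     (fun x : 'rV[T]_n => x ord0 i) measurable)) => //.
move=> _ [A + <-]; rewrite -bigcup_seq/= => -[i _ [B mB <-]].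
rewrite !setTI.
have -> : @row_of_tuple T n @^-1` ((fun x : 'rV[T]_n => x ord0 i) @^-1` B) =
    (fun t : n.-tuple T => tnth t i) @^-1` B.
  by apply/seteqP; split => t /=; rewrite mxE.
by rewrite -[X in measurable X]setTI; exact: measurable_tnth.
Qed.

Section cons_measure.
Context {disp : measure_display} {T : measurableType disp} {R : realType}.
Context {n : nat}.

Definition cons_pair (z : T * n.-tuple T) : n.+1.-tuple T :=
  [tuple of z.1 :: z.2].

Lemma measurable_cons_pair : measurable_fun [set: T * n.-tuple T] cons_pair.
Proof. exact: measurable_cons. Qed.

Variables (m : {sigma_finite_measure set T -> \bar R}).
Variables (m' : {sigma_finite_measure set (n.-tuple T) -> \bar R}).

Definition cons_measure : set (n.+1.-tuple T) -> \bar R :=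
  pushforward (m \x m')%E cons_pair.

Let cons_measure0 : cons_measure set0 = 0%E.
Proof. by rewrite /cons_measure /pushforward preimage_set0 measure0. Qed.

Let cons_measure_ge0 A : (0 <= cons_measure A)%E.
Proof. exact: (measure_ge0 (m \x m')%E). Qed.

Let cons_measure_sigma_additive : semi_sigma_additive cons_measure.
Proof.
move=> F mF tF mUF; rewrite /cons_measure /pushforward preimage_bigcup.
apply: measure_semi_sigma_additive.
- move=> k; rewrite -[X in measurable X]setTI.
  exact: measurable_cons_pair.
- apply/trivIsetP => /= i j _ _ ij; rewrite -preimage_setI.
  by move/trivIsetP : tF => /(_ _ _ _ _ ij) ->//; rewrite preimage_set0.
- rewrite -preimage_bigcup -[X in measurable X]setTI.
  exact: measurable_cons_pair.
Qed.

HB.instance Definition _ := isMeasure.Build _ _ _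
  cons_measure cons_measure0 cons_measure_ge0 cons_measure_sigma_additive.

Let cons_measure_sigma_finite : sigma_finite setT cons_measure.
Proof.
have /sigma_finiteP[G [GT ndG Goo]] := sigma_finiteT m'.
have /sigma_finiteP[F [FT ndF Foo]] := sigma_finiteT m.
pose uncons (t : n.+1.-tuple T) : T * n.-tuple T :=
  (thead t, [tuple of behead t]).
have muncons : measurable_fun [set: n.+1.-tuple T] uncons.
  apply/measurable_fun_pairP; split; first exact: measurable_tnth.
  exact: measurable_behead.
exists (fun i => uncons @^-1` (F i `*` G i)).
  apply/seteqP; split => // t _.
  have [i _ Fi] : (\bigcup_i F i) (thead t) by rewrite -FT.
  have [j _ Gj] : (\bigcup_i G i) [tuple of behead t] by rewrite -GT.
  exists (maxn i j) => //; split => /=.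
    by apply: (subsetPset _ _ (ndF _ _ (leq_maxl i j))).
  by apply: (subsetPset _ _ (ndG _ _ (leq_maxr i j))).
move=> i; have [mFi Fioo] := Foo i; have [mGi Gioo] := Goo i; split.
  by rewrite -[X in measurable X]setTI; apply: muncons => //; exact: measurableX.
rewrite /cons_measure /pushforward -comp_preimage.
rewrite (_ : uncons \o cons_pair = id); last first.
  by apply/funext => -[x t]; congr pair; exact/val_inj.
by rewrite preimage_id product_measure1E// lte_mul_pinfty// ge0_fin_numE.
Qed.

HB.instance Definition _ := Measure_isSigmaFinite.Build _ _ _
  cons_measure cons_measure_sigma_finite.

End cons_measure.

Fixpoint power_measure disp (T : measurableType disp) (R : realType)
    (m : {sigma_finite_measure set T -> \bar R}) (n : nat) :
    {sigma_finite_measure set (n.-tuple T) -> \bar R} :=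
  match n with
  | 0 => dirac [tuple]
  | n'.+1 => cons_measure m (power_measure m n')
  end.

Section lebesgue_rV.
Context {R : realType} {d : nat}.
Local Notation V := 'rV[R]_d.

Definition lebesgue_rV : set V -> \bar R :=
  pushforward (power_measure (@lebesgue_measure R) d) (@row_of_tuple R d).

Let lebesgue_rV0 : lebesgue_rV set0 = 0%E.
Proof. by rewrite /lebesgue_rV /pushforward preimage_set0 measure0. Qed.

Let lebesgue_rV_ge0 A : (0 <= lebesgue_rV A)%E.
Proof. exact: (measure_ge0 (power_measure (@lebesgue_measure R) d)). Qed.

(* The domain of lebesgue_measure, measurableTypeR R, and R carry the same
   sigma-algebra under different displays. *)
Let measurable_preimage_row (A : set V) : measurable A ->
  measurable ((@row_of_tuple R d : d.-tuple (measurableTypeR R) -> V) @^-1` A).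
Proof.
move=> mA; have := @measurable_row_of_tuple _ R d measurableT A mA.
by rewrite setTI.
Qed.

Let lebesgue_rV_sigma_additive : semi_sigma_additive lebesgue_rV.
Proof.
move=> F mF tF mUF; rewrite /lebesgue_rV /pushforward preimage_bigcup.
apply: (@measure_semi_sigma_additive _ _ _ (power_measure lebesgue_measure d)).
- by move=> k; exact: measurable_preimage_row.
- apply/trivIsetP => /= i j _ _ ij; rewrite -preimage_setI.
  by move/trivIsetP : tF => /(_ _ _ _ _ ij) ->//; rewrite preimage_set0.
- by rewrite -preimage_bigcup; exact: measurable_preimage_row.
Qed.

HB.instance Definition _ := isMeasure.Build _ _ _
  lebesgue_rV lebesgue_rV0 lebesgue_rV_ge0 lebesgue_rV_sigma_additive.

End lebesgue_rV.

Section minimax.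
Context {R : realType} {d : nat}.
Local Notation V := 'rV[R]_d.

(* The library norm on 'rV[R]_d is the sup norm. *)
Definition enorm (x : V) : R := Num.sqrt (\sum_(i < d) x ord0 i ^+ 2).

(* Iterated directional derivative D_(h_1) ... D_(h_k) f; where f is of class
   C^k this is the k-linear form \nabla^k f(x) applied to (h_1, ..., h_k). *)
Definition iter_derive (hs : seq V) (f : V -> R) : V -> R :=
  foldr (fun h g => 'D_h g) f hs.

Definition basis_vec (i : 'I_d) : V := delta_mx ord0 i.

Definition iter_partial (s : seq 'I_d) (f : V -> R) : V -> R :=
  iter_derive (map basis_vec s) f.

(* Only meaningful for S open, since derivable looks at a neighbourhood of x. *)
Definition class_C (k : nat) (S : set V) (f : V -> R) : Prop :=
  forall (s : seq 'I_d) (x : V), (size s <= k)%N -> S x ->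
    {for x, continuous (iter_partial s f)} /\
    ((size s < k)%N -> forall i, derivable (iter_partial s f) x (basis_vec i)).

Definition hessian (f : V -> R) (x : V) : 'M[R]_d :=
  \matrix_(i, j) iter_partial [:: i; j] f x.

Definition loewner_le (A B : 'M[R]_d) : Prop :=
  forall h : V, (h *m A *m h^T) ord0 ord0 <= (h *m B *m h^T) ord0 ord0.

(* Operator norm of \nabla^k f(x); it is |f x| for k = 0. *)
Definition nabla_norm (k : nat) (f : V -> R) (x : V) : \bar R :=
  ereal_sup [set `|iter_derive hs f x|%:E | hs in
    [set hs : k.-tuple V | forall i, enorm (tnth hs i) = 1]].

(* Multi-indices of length at most k have entries at most k. *)
Definition mindex (k : nat) := {ffun 'I_d -> 'I_k.+1}.

Definition mlength k (nu : mindex k) : nat := (\sum_(i < d) nu i)%N.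

Definition mpartial k (nu : mindex k) : (V -> R) -> V -> R :=
  iter_partial (flatten [seq nseq (nu i) i | i <- enum 'I_d]).

Definition holder_seminorm (alpha : R) (S : set V) (g : V -> R) : \bar R :=
  ereal_sup [set (`|g z.1 - g z.2| / enorm (z.1 - z.2) `^ alpha)%:E | z in
    [set z : V * V | [/\ S z.1, S z.2 & z.1 != z.2]]].

Definition Loo_norm (S : set V) (g : V -> R) : \bar R :=
  'N[lebesgue_rV]_+oo%E [(EFin \o g) \_ S]%E.

Definition holder_norm (eta : R) (S : set V) (f : V -> R) : \bar R :=
  let k := Num.truncn eta in
  (\sum_(nu : mindex k | (mlength nu <= k)%N) Loo_norm S (mpartial nu f) +
   \sum_(nu : mindex k | mlength nu == k)
      holder_seminorm (eta - k%:R) S (mpartial nu f))%E.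

Definition holder_ball (eta K : R) (S : set V) : set (V -> R) :=
  [set f | class_C (Num.truncn eta) S f /\ (holder_norm eta S f <= K%:E)%E].

Definition support (p : V -> R) : set V := [set x | p x != 0].

Definition argmin (u : V -> \bar R) : set V :=
  [set x | forall y, (u x <= u y)%E].

(* The representation p = exp(- u + a). Here support p = {u < +oo}, and
   real-valued operations on u are applied to fine \o u. The last condition
   makes support p open. It is stated for x in the support only: when
   u x = +oo the radius is 0 and the right-hand side is +oo. *)
Definition admissible (beta K : R) (p : V -> R) (u : V -> \bar R)
    (a : V -> R) : Prop :=
  [/\ (forall x, u x != -oo%E) /\
        (forall x, (p x)%:E = expeR (- u x + (a x)%:E)%E),
      holder_ball beta K (support p) a /\
        class_C (1 + maxn 1 (Num.truncn beta)) (support p) (fine \o u),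
      forall x, support p x -> loewner_le (K^-1)%:M (hessian (fine \o u) x),
      argmin u !=set0 /\ (forall x, argmin u x -> enorm x <= K) &
      forall x y, support p x ->
        enorm (x - y) <= (K * Num.max 1 `|fine (u x)|) `^ (- K) ->
        support p y /\
        forall k, (k <= (Num.truncn beta).+1)%N ->
          (nabla_norm k (fine \o u) y <= (K * (1 + `|fine (u x)| `^ K))%:E)%E].

Definition has_density (P : set V -> \bar R) (p : V -> R) : Prop :=
  [/\ measurable_fun [set: V] p, forall x, 0 <= p x &
      forall A, measurable A -> P A = (\int[lebesgue_rV]_(x in A) (p x)%:E)%E].

(* The model: probability measures are identified with their densities. *)
Definition model (beta K : R) : set (probability V R) :=
  [set P | exists p u a, has_density P p /\ admissible beta K p u a].

Definition coupling (mu nu : set V -> \bar R) : set (probability (V * V)%type R) :=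
  [set pi | (forall A, measurable A -> pi (A `*` setT) = mu A) /\
            (forall A, measurable A -> pi (setT `*` A) = nu A)].

Definition W1 (mu nu : set V -> \bar R) : \bar R :=
  ereal_inf [set (\int[pi]_z (enorm (z.1 - z.2))%:E)%E | pi in coupling mu nu].

(* An estimator is a measurable map from samples to probability measures. *)
Definition risk (n : nat) (phat : R.-pker (n.-tuple V) ~> V)
    (P : probability V R) : \bar R :=
  (\int[power_measure P n]_X W1 P (phat X))%E.

Definition minimax_risk (beta K : R) (n : nat) : \bar R :=
  ereal_inf [set ereal_sup [set risk phat P | P in model beta K]
            | phat in [set: R.-pker (n.-tuple V) ~> V]].

End minimax.
Arguments minimax_risk R d beta K n : clear implicits.

(* Main.v *)
From HB Require Import structures.
Require Import Defs.
From mathcomp Require Import all_boot all_order all_algebra.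
From mathcomp Require Import all_classical all_reals all_analysis.
From mathcomp Require Import measurable_realfun ess_sup_inf normal_distribution.
From mathcomp Require Import ring lra.

(** Assouad's argument.  With u the standard Gaussian potential (up to a
    constant) and h of order n^(-1/(2 beta + d)), let a be a sum of bumps of
    height +- kappa h^beta supported in disjoint cubes of half-side h, so that
    the Hölder norm of a is at most 1 whatever the signs are.  The bumps come
    in pairs carrying opposite signs at x and -x; hence a is odd, and since the
    Gaussian is even and |a| does not depend on the signs, neither does the
    normalization of exp(-u + a).  Flipping the sign of one pair changes the
    law of one observation by O(h^(2 beta + d)) = O(1/n) in squared Hellinger
    distance, so n observations do not determine that sign.  A wrong sign costs
    of order h^(beta + d + 1) when tested against a Lipschitz function supported
    in the two cubes; these test functions can be added up over the h^(-d)
    pairs, and the easy half of Kantorovich duality turns the sum into a lower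
    bound of order h^(beta + 1) for the Wasserstein risk. *)

Set Implicit Arguments.
Unset Strict Implicit.
Unset Printing Implicit Defensive.
Import Order.TTheory GRing.Theory Num.Theory.
Import numFieldNormedType.Exports.
Local Open Scope classical_set_scope.
Local Open Scope ring_scope.

(** * Integration against product measures *)

(** The Gaussian has full support, so the conditions on [u] concern a fixed quadratic, and only [a]
    carries the unknown signs. The normalizing constant is absorbed into the additive constant of
    [u], so that [a] is exactly the sum of bumps. That additive constant must be at least 1 for the
    growth condition on [u] to be verified; here this is derived from [3 <= d]. The obstacle is the
    normalization: if it moved with the signs, one flip would alter the density everywhere instead
    of in two cells. Once it is fixed, a flip is local and the geometric mean of the two densities
    is an explicit exponential. Laws are compared relative to the Gaussian law rather than to
    Lebesgue measure, so that all densities and test functions are bounded functions under a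
    probability measure. The Wasserstein loss may be infinite, and its measurability in the sample
    is never established; Assouad's lemma therefore asks only that the loss dominate a sum of
    measurable coordinate losses. *)

Section power_integrals.
Local Open Scope ereal_scope.

Lemma integral_density d (T : measurableType d) (R : realType)
    (nu : {finite_measure set T -> \bar R})
    (mu : {sigma_finite_measure set T -> \bar R}) (f : T -> R) :
  measurable_fun [set: T] f -> (forall x, (0 <= f x)%R) ->
  (forall A, measurable A -> nu A = \int[mu]_(x in A) (f x)%:E) ->
  forall g : T -> \bar R, measurable_fun [set: T] g -> (forall x, 0 <= g x) ->
  \int[nu]_x g x = \int[mu]_x (g x * (f x)%:E).
Proof.
move=> mf f0 nuE g mg g0.
have mfE : measurable_fun [set: T] (EFin \o f) by exact/measurable_EFinP.
have numu : nu `<< mu.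
  apply/null_content_dominatesP => A mA muA; rewrite nuE//.
  by apply: null_set_integral => //; exact: measurable_funTS.
rewrite -(Radon_Nikodym_SigmaFinite.change_of_variables numu)//.
have intF := Radon_Nikodym_SigmaFinite.f_integrable numu.
apply: ae_eq_integral => //.
- by apply: emeasurable_funM => //; exact: measurable_int intF.
- exact: emeasurable_funM.
(* [f] and the Radon-Nikodym derivative both integrate to [nu] over every measurable set, hence
   agree almost everywhere. *)
- apply: ae_eqe_mul2l; apply: integral_ae_eq => // A _ mA.
  by rewrite -Radon_Nikodym_SigmaFinite.f_integral// nuE.
Qed.

Lemma measurable_prod_tnth d (T : measurableType d) (R : realType) n
    (f : 'I_n -> T -> R) : (forall i, measurable_fun [set: T] (f i)) ->
  measurable_fun [set: n.-tuple T] (fun t => \prod_(i < n) f i (tnth t i))%R.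
Proof.
move=> mf; apply: measurable_prod => i _.
exact: (measurableT_comp (mf i) (measurable_tnth i)).
Qed.

Lemma integral_powerS d (T : measurableType d) (R : realType)
    (m : {sigma_finite_measure set T -> \bar R}) n
    (g : n.+1.-tuple T -> \bar R) :
  measurable_fun [set: n.+1.-tuple T] g -> (forall t, 0 <= g t) ->
  \int[power_measure m n.+1]_t g t =
    \int[m]_x \int[power_measure m n]_t g [tuple of x :: t].
Proof.
move=> mg g0.
have mc := @measurable_cons_pair _ T n.
rewrite (ge0_integral_pushforward mc (m \x power_measure m n))//= .
rewrite (fubini_tonelli1 (g \o cons_pair)) => [//||z]; last exact: g0.
exact: (measurableT_comp mg mc).
Qed.

Lemma measurable_map_tuple d d' (T : measurableType d) (T' : measurableType d')
    n (phi : T -> T') : measurable_fun [set: T] phi ->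
  measurable_fun [set: n.-tuple T] (map_tuple phi : n.-tuple T -> n.-tuple T').
Proof.
move=> mphi; apply/measurable_fun_tnthP => i.
rewrite (_ : _ \o _ = phi \o (fun t => tnth t i)).
  exact: measurableT_comp (measurable_tnth i).
by apply/funext => t /=; rewrite tnth_map.
Qed.

(** One induction serves two purposes: with [phi] the identity and [f] a density it gives the joint
    density of a sample, with [phi] the reflection and [f] constant it gives the symmetry of
    Lebesgue measure on row vectors. *)
Lemma integral_power_change d d' (T : measurableType d) (T' : measurableType d')
    (R : realType) (mu : {sigma_finite_measure set T -> \bar R})
    (nu : {sigma_finite_measure set T' -> \bar R}) (phi : T -> T') (f : T -> R) :
  measurable_fun [set: T] phi ->
  measurable_fun [set: T] f -> (forall x, (0 <= f x)%R) ->
  (forall h : T' -> \bar R, measurable_fun [set: T'] h -> (forall x, 0 <= h x) ->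
    \int[nu]_x h x = \int[mu]_x (h (phi x) * (f x)%:E)) ->
  forall n (g : n.-tuple T' -> \bar R),
  measurable_fun [set: n.-tuple T'] g -> (forall t, 0 <= g t) ->
  \int[power_measure nu n]_t g t =
    \int[power_measure mu n]_t
      (g (map_tuple phi t) * (\prod_(i < n) f (tnth t i))%:E).
Proof.
move=> mphi mf f0 H.
have mgp n (g : n.-tuple T' -> \bar R) : measurable_fun [set: n.-tuple T'] g ->
    measurable_fun [set: n.-tuple T] (fun t : n.-tuple T =>
      g (map_tuple phi t) * (\prod_(i < n) f (tnth t i))%:E).
  move=> mg; apply: emeasurable_funM.
    exact: (measurableT_comp mg (measurable_map_tuple mphi)).
  by apply/measurable_EFinP; exact: (measurable_prod_tnth (fun=> mf)).
elim=> [|n IH] g mg g0.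
  rewrite /= !integral_dirac//; last exact: mgp.
  rewrite !diracE !in_setT !mul1e big_ord0 mule1.
  by congr g; apply/val_inj.
have mgpn := mgp _ _ mg.
have mcons (x : T') : measurable_fun [set: n.-tuple T']
    (fun t => [tuple of x :: t]).
  exact: measurable_cons.
have mconsT (x : T) : measurable_fun [set: n.-tuple T]
    (fun t => [tuple of x :: t]).
  exact: measurable_cons.
rewrite !integral_powerS//; last first.
  by move=> t; rewrite mule_ge0// lee_fin prodr_ge0.
rewrite H; last 2 first.
- apply: (measurable_fun_fubini_tonelli_F (g \o cons_pair)) => [|z].
    exact: (measurableT_comp mg (@measurable_cons_pair _ _ _)).
  exact: g0.
- by move=> x; apply: integral_ge0 => t _; exact: g0.
apply: eq_integral => x _; rewrite IH//; last first.
  exact: measurableT_comp (mcons _).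
rewrite -ge0_integralZr//.
- apply: eq_integral => t _; rewrite -muleA -EFinM big_ord_recl mulrC.
  congr (g _ * _); first by apply/val_inj.
  rewrite -[RHS]/((f x * _)%:E); congr (_ * _)%:E.
  by apply: eq_bigr => i _; rewrite !(tnth_nth x).
- apply: emeasurable_funM.
    apply: (measurableT_comp mg); apply: (measurableT_comp (mcons (phi x))).
    exact: measurable_map_tuple.
  by apply/measurable_EFinP; exact: (measurable_prod_tnth (fun=> mf)).
- by move=> t _; rewrite mule_ge0// lee_fin prodr_ge0.
- by rewrite lee_fin.
Qed.

(** Used both for the tensorization of the Hellinger affinity, where all factors are equal, and for
    integrals of product functions against [lebesgue_rV]. *)
Lemma integral_power_prod d (T : measurableType d) (R : realType)
    (mu : {sigma_finite_measure set T -> \bar R}) n (f : 'I_n -> T -> R)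
    (c : 'I_n -> R) :
  (forall i, measurable_fun [set: T] (f i)) -> (forall i x, (0 <= f i x)%R) ->
  (forall i, \int[mu]_x (f i x)%:E = (c i)%:E) ->
  \int[power_measure mu n]_t (\prod_(i < n) f i (tnth t i))%:E =
    (\prod_(i < n) c i)%:E.
Proof.
elim: n f c => [|n IH] f c mf f0 fc.
  rewrite /= integral_dirac//; last first.
    by apply/measurable_EFinP; exact: measurable_prod_tnth.
  by rewrite diracE in_setT mul1e !big_ord0.
rewrite integral_powerS//; last 2 first.
- by apply/measurable_EFinP; exact: measurable_prod_tnth.
- by move=> t; rewrite lee_fin prodr_ge0.
rewrite big_ord_recl EFinM -fc -ge0_integralZr//; last 3 first.
- by apply/measurable_EFinP.
- by move=> x _; rewrite lee_fin.
- rewrite lee_fin prodr_ge0// => i _; rewrite -lee_fin -fc.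
  by apply: integral_ge0 => x _; rewrite lee_fin.
apply: eq_integral => x _.
rewrite -(IH (fun i => f (lift ord0 i)))// -ge0_integralZl//; last 3 first.
- apply/measurable_EFinP.
  exact: (measurable_prod_tnth (fun i => mf (lift ord0 i))).
- by move=> t _; rewrite lee_fin prodr_ge0.
- by rewrite lee_fin.
apply: eq_integral => t _; rewrite big_ord_recl EFinM -!EFinM.
rewrite -[LHS]/((f ord0 x * _)%:E); congr (_ * _)%:E.
by apply: eq_bigr => i _; rewrite !(tnth_nth x).
Qed.

End power_integrals.

(** * Lipschitz test functions and the Wasserstein distance *)

Lemma bounded_integrable d (T : measurableType d) (R : realType)
    (mu : {measure set T -> \bar R}) (f : T -> R) (B : R) :
  (mu setT < +oo)%E -> measurable_fun [set: T] f ->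
  (forall x, `|f x| <= B) -> mu.-integrable [set: T] (EFin \o f).
Proof.
move=> muoo mf fB; apply: measurable_bounded_integrable => //.
by exists B; split; [exact: num_real|move=> M BM x _; exact: le_trans (fB x) (ltW BM)].
Qed.

Lemma measurable_coord d (T : measurableType d) n (i : 'I_n) :
  measurable_fun [set: 'rV[T]_n] (fun x : 'rV[T]_n => x ord0 i).
Proof.
move=> _ B mB; rewrite setTI; apply: sub_sigma_algebra.
rewrite -bigcup_seq; exists i; first by rewrite /= mem_index_enum.
by exists B => //; rewrite setTI.
Qed.

Section W1_lower_bound.
Context {R : realType} {d : nat}.
Local Notation V := 'rV[R]_d.

(** Both integrals can be taken against an arbitrary coupling, where their difference is at most the
    transport cost. The bound [B] makes them finite, so that passing to real-valued integrals loses
    nothing. *)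
Lemma W1_ge_test (P Q : {measure set V -> \bar R}) (f : V -> R) (B : R) :
  (P setT < +oo)%E -> (Q setT < +oo)%E ->
  measurable_fun [set: V] f -> (forall x, `|f x| <= B) ->
  (forall x y, `|f x - f y| <= enorm (x - y)) ->
  ((\int[P]_x f x - \int[Q]_x f x)%R%:E <= W1 P Q)%E.
Proof.
move=> Poo Qoo mf fB fL.
have mfE : measurable_fun [set: V] (EFin \o f) by exact/measurable_EFinP.
have iP := bounded_integrable Poo mf fB.
have iQ := bounded_integrable Qoo mf fB.
apply/ereal_infP => _ [pi [piP piQ] <-].
have mf1 : measurable_fun [set: V * V] (f \o fst) by exact: measurableT_comp.
have mf2 : measurable_fun [set: V * V] (f \o snd) by exact: measurableT_comp.
have pioo : (pi setT < +oo)%E by rewrite probability_setT ltry.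
have i1 : pi.-integrable [set: V * V] (EFin \o (f \o fst)).
  by apply: (bounded_integrable (B := B)) => // z; exact: fB.
have i2 : pi.-integrable [set: V * V] (EFin \o (f \o snd)).
  by apply: (bounded_integrable (B := B)) => // z; exact: fB.
have -> : \int[P]_x f x = \int[pi]_z f z.1.
  congr fine; transitivity (\int[pushforward pi fst]_x (f x)%:E)%E; last first.
    by rewrite (integral_pushforward measurable_fst).

  apply: eq_measure_integral => A mA _; rewrite -piP//.
  by congr (pi _); apply/seteqP; split => [z [] | z].
have -> : \int[Q]_x f x = \int[pi]_z f z.2.
  congr fine; transitivity (\int[pushforward pi snd]_x (f x)%:E)%E; last first.
    by rewrite (integral_pushforward measurable_snd).

  apply: eq_measure_integral => A mA _; rewrite -piQ//.
  by congr (pi _); apply/seteqP; split => [z [] | z].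
rewrite -RintegralB// fineK; last first.
  apply: integrable_fin_num => //.
  apply: (bounded_integrable (B := B + B)) => //; first exact: measurable_funB.
  by move=> z; apply: (le_trans (ler_normB _ _)); apply: lerD; exact: fB.
apply: le_trans (lee_abs _) _.
have mB : measurable_fun [set: V * V] (fun z => (f z.1 - f z.2)%:E).
  by apply/measurable_EFinP; exact: measurable_funB.
apply: (le_trans (le_abse_integral _ _ mB)) => //.
apply: ge0_le_integral => //=.
  exact/measurable_EFinP/measurableT_comp/measurable_funB.
- apply/measurable_EFinP.
  have ms := continuous_measurable_fun (@sqrt_continuous R).
  suff mg : measurable_fun [set: V * V] (fun z : V * V =>
      \sum_(i < d) (z.1 - z.2) ord0 i ^+ 2).
    exact: (measurableT_comp ms mg).
  apply: measurable_sum => i; apply: measurable_funX.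
  under eq_fun do rewrite !mxE.
  by apply: measurable_funB; apply: (measurableT_comp (measurable_coord i)).
- by move=> z _; rewrite lee_fin.
Qed.

Lemma Rintegral_linear_comb (P : {measure set V -> \bar R}) (J : finType)
    (tau : J -> R) (g : J -> V -> R) :
  (forall j, P.-integrable [set: V] (EFin \o g j)) ->
  \int[P]_x (\sum_j tau j * g j x) = \sum_j tau j * \int[P]_x g j x.
Proof.
move=> ig.
rewrite /Rintegral; under eq_integral do rewrite -sumEFin.
rewrite integral_sum//; last first.
  move=> j; have := integrableZl measurableT (tau j) (ig j).
  by congr integrable; apply/funext => x; rewrite /= EFinM.
transitivity (fine (\sum_j (tau j * \int[P]_x g j x)%:E)%E); last by rewrite sumEFin.
congr fine; apply: eq_bigr => j _.
rewrite EFinM fineK ?integrable_fin_num//; last exact: ig.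
by under eq_integral do rewrite EFinM; rewrite integralZl//; exact: ig.
Qed.

(** Test against the combination whose coefficients are the signs of the individual gaps. Those
    signs depend on [P] and [Q], hence the Lipschitz hypothesis for all coefficients in [-1, 1]. *)
Lemma W1_ge_sum (P Q : {measure set V -> \bar R}) (J : finType)
    (g : J -> V -> R) (B : R) :
  (P setT < +oo)%E -> (Q setT < +oo)%E ->
  (forall j, measurable_fun [set: V] (g j)) -> (forall j x, `|g j x| <= B) ->
  (forall tau : J -> R, (forall j, `|tau j| <= 1) -> forall x y,
    `|\sum_j tau j * g j x - \sum_j tau j * g j y| <= enorm (x - y)) ->
  ((\sum_j `|\int[P]_x g j x - \int[Q]_x g j x|)%R%:E <= W1 P Q)%E.
Proof.
move=> Poo Qoo mg gB gL.
pose tau j := Num.sg (\int[P]_x g j x - \int[Q]_x g j x).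
have tau1 j : `|tau j| <= 1 by rewrite /tau normr_sg; case: (_ != 0).
pose f x := \sum_j tau j * g j x.
have mf : measurable_fun [set: V] f.
  by apply: measurable_sum => j; apply: measurable_funM.
have fB x : `|f x| <= \sum_(j : J) B.
  apply: (le_trans (ler_norm_sum _ _ _)); apply: ler_sum => j _.
  by rewrite normrM (le_trans _ (gB j x))// ler_piMl.
have := W1_ge_test Poo Qoo mf fB (gL _ tau1).
rewrite !Rintegral_linear_comb; last 2 first.
- by move=> j; exact: bounded_integrable (gB j).
- by move=> j; exact: bounded_integrable (gB j).
apply: le_trans; rewrite -sumrB lee_fin; apply: ler_sum => j _.
by rewrite -mulrBr normrEsg.
Qed.
End W1_lower_bound.

(** * Assouad's lemma *)

(** The integral of a nonnegative function is a supremum over simple functions below it, so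
    monotonicity needs no measurability. This is what allows integrating the Wasserstein loss. *)
Lemma ge0_le_integral_nonmeas d (T : measurableType d) (R : realType)
    (mu : {measure set T -> \bar R}) (f g : T -> \bar R) :
  (forall x, (0 <= f x)%E) -> (forall x, (f x <= g x)%E) ->
  (\int[mu]_x f x <= \int[mu]_x g x)%E.
Proof.
move=> f0 fg; have g0 x : (0 <= g x)%E by exact: le_trans (fg x).
rewrite !ge0_integralTE//; apply/ereal_supP => _ [h hf <-].
by apply: ereal_sup_ubound; exists h => //= x; exact: le_trans (fg x).
Qed.

(* The weights 1/2 and 1/16 come from optimizing min(a, b) >= 2 s r - s^2 (a + b)
   at s = 1/4. *)
Lemma testing_ineq (R : realFieldType) (a b r x y D : R) :
  0 <= a -> 0 <= b -> 0 <= r -> r ^+ 2 = a * b -> 0 <= x -> 0 <= y -> 0 <= D ->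
  D <= x + y -> D / 2 * r <= x * a + y * b + D / 16 * (a + b).
Proof.
move=> a0 b0 r0 rab x0 y0 D0 Dxy.
have ra : r / 2 <= a + b / 16.
  rewrite -(@ler_pXn2r _ 2)// ?nnegrE; [|lra|lra].
  rewrite expr_div_n rab -subr_ge0.
  have -> : (a + b / 16) ^+ 2 - a * b / 2 ^+ 2 = (a - b / 16) ^+ 2 by field.
  exact: sqr_ge0.
have rb : r / 2 <= b + a / 16.
  rewrite -(@ler_pXn2r _ 2)// ?nnegrE; [|lra|lra].
  rewrite expr_div_n rab -subr_ge0.
  have -> : (b + a / 16) ^+ 2 - a * b / 2 ^+ 2 = (b - a / 16) ^+ 2 by field.
  exact: sqr_ge0.
have [ab|ba] := leP a b.
  have h1 : D * (r / 2) <= D * (a + b / 16) by exact: ler_wpM2l.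
  have h2 : D * a <= (x + y) * a by exact: ler_wpM2r.
  have h3 : y * a <= y * b by exact: ler_wpM2l.
  have h4 : 0 <= D * a by exact: mulr_ge0.
  have -> : D / 2 * r = D * (r / 2) by field.
  lra.
have h1 : D * (r / 2) <= D * (b + a / 16) by exact: ler_wpM2l.
have h2 : D * b <= (x + y) * b by exact: ler_wpM2r.
have h3 : x * b <= x * a by apply: ler_wpM2l => //; exact: ltW.
have h4 : 0 <= D * b by exact: mulr_ge0.
have -> : D / 2 * r = D * (r / 2) by field.
lra.
Qed.

(** [has_density] for an arbitrary reference measure: both Lebesgue measure and the Gaussian law
    play that part. *)
Definition is_density d (T : measurableType d) (R : realType)
    (mu : {measure set T -> \bar R}) (P : set T -> \bar R) (p : T -> R) : Prop :=
  [/\ measurable_fun [set: T] p, forall x, 0 <= p x &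
      forall A, measurable A -> P A = (\int[mu]_(x in A) (p x)%:E)%E].

Section two_points.
Context d (T : measurableType d) (R : realType).
Variables (mu : {sigma_finite_measure set T -> \bar R}).

Lemma integral_power_density (P : probability T R) (p : T -> R) n
    (g : n.-tuple T -> R) : is_density mu P p ->
  measurable_fun [set: n.-tuple T] g -> (forall t, 0 <= g t) ->
  (\int[power_measure P n]_t (g t)%:E =
   \int[power_measure mu n]_t (g t * \prod_(i < n) p (tnth t i))%:E)%E.
Proof.
move=> [mp p0 Pp] mg g0.
have H (h : T -> \bar R) : measurable_fun [set: T] h -> (forall x, 0 <= h x)%E ->
    (\int[P]_x h x = \int[mu]_x (h x * (p x)%:E))%E.
  exact: integral_density Pp h.
rewrite (integral_power_change (@measurable_id _ _ _) mp p0 H)//.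
  apply: eq_integral => t _; rewrite EFinM; congr (_ * _)%E; congr (g _)%:E.
  by apply/val_inj; rewrite /= map_id.
exact/measurable_EFinP.
Qed.

(** Le Cam's two-point method. Integrate [testing_ineq] at the two sample likelihoods: their
    geometric mean has integral [rho ^+ n], at least 1/2, and each likelihood has integral 1, which
    leaves Delta/4 - 2 Delta/16 = Delta/8. *)
Lemma two_point_lower_bound (P P' : probability T R) (p p' r : T -> R) (rho : R)
    n (D D' : n.-tuple T -> R) (Delta : R) :
  is_density mu P p -> is_density mu P' p' ->
  measurable_fun [set: T] r -> (forall x, 0 <= r x) ->
  (forall x, r x ^+ 2 = p x * p' x) -> (\int[mu]_x (r x)%:E = rho%:E)%E ->
  2^-1 <= rho ^+ n ->
  measurable_fun [set: n.-tuple T] D -> measurable_fun [set: n.-tuple T] D' ->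
  (forall t, 0 <= D t) -> (forall t, 0 <= D' t) ->
  0 <= Delta -> (forall t, Delta <= D t + D' t) ->
  ((Delta / 8)%:E <=
    \int[power_measure P n]_t (D t)%:E + \int[power_measure P' n]_t (D' t)%:E)%E.
Proof.
move=> dP dP' mr r0 r2 rint rhon mD mD' D0 D'0 Delta0 DD'.
have [[mp p0 Pp] [mp' p'0 Pp']] := (dP, dP').
rewrite !(integral_power_density (p := p) dP)// !(integral_power_density dP')//.
pose prodn (f : T -> R) (t : n.-tuple T) := \prod_(i < n) f (tnth t i).
have mprodn (f : T -> R) : measurable_fun [set: T] f -> measurable_fun setT (prodn f).
  by move=> mf; exact: (measurable_prod_tnth (fun=> mf)).
have prodn0 (f : T -> R) : (forall x, 0 <= f x) -> forall t, 0 <= prodn f t.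
  by move=> f0 t; exact: prodr_ge0.
have int_prodn (f : T -> R) (c : R) : measurable_fun [set: T] f -> (forall x, 0 <= f x) ->
    (\int[mu]_x (f x)%:E = c%:E -> \int[power_measure mu n]_t (prodn f t)%:E = (c ^+ n)%:E)%E.
  move=> mf f0 fc; rewrite (integral_power_prod (f := fun=> f) (c := fun=> c))//.
  by rewrite prodr_const card_ord.
have int1 (Q : probability T R) q : is_density mu Q q ->
    (\int[power_measure mu n]_t (prodn q t)%:E = 1)%E.
  move=> [mq q0 Qq]; rewrite (int_prodn _ 1)//; first by rewrite expr1n.
  by rewrite -Qq// probability_setT.
have mL := mprodn _ mp; have mL' := mprodn _ mp'; have mr' := mprodn _ mr.
have key : ((Delta / 2 * rho ^+ n)%:E <=
    \int[power_measure mu n]_t ((D t * prodn p t)%:E + (D' t * prodn p' t)%:E +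
      ((Delta / 16)%:E * (prodn p t)%:E + (Delta / 16)%:E * (prodn p' t)%:E)))%E.
  rewrite EFinM -(int_prodn r rho)// -ge0_integralZl//; last 3 first.
  - exact/measurable_EFinP.
  - by move=> t _; rewrite lee_fin prodn0.
  - by rewrite lee_fin divr_ge0.
  apply: ge0_le_integral => //.
  - by move=> t _; rewrite mule_ge0// lee_fin ?prodn0 ?divr_ge0.
  - by apply: emeasurable_funM => //; exact/measurable_EFinP.
  - by apply: emeasurable_funD; apply: emeasurable_funD => //;
      apply/measurable_EFinP; apply: measurable_funM.
  move=> t _; rewrite -!EFinM -!EFinD lee_fin.
  have Lr : prodn r t ^+ 2 = prodn p t * prodn p' t.
    by rewrite -prodrXl -big_split; apply: eq_bigr => i _.
  have := testing_ineq (prodn0 _ p0 t) (prodn0 _ p'0 t) (prodn0 _ r0 t) Lr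
    (D0 t) (D'0 t) Delta0 (DD' t).
  by rewrite /prodn; lra.
have mDL : measurable_fun setT (fun t => (D t * prodn p t)%:E).
  by apply/measurable_EFinP; exact: measurable_funM.
have mDL' : measurable_fun setT (fun t => (D' t * prodn p' t)%:E).
  by apply/measurable_EFinP; exact: measurable_funM.
have DL0 t : (0 <= (D t * prodn p t)%:E)%E by rewrite lee_fin mulr_ge0 ?prodn0.
have DL'0 t : (0 <= (D' t * prodn p' t)%:E)%E by rewrite lee_fin mulr_ge0 ?prodn0.
have cL0 (q : T -> R) t : (forall x, 0 <= q x) -> (0 <= (Delta / 16)%:E * (prodn q t)%:E)%E.
  by move=> q0; rewrite -EFinM lee_fin mulr_ge0 ?prodn0 ?divr_ge0.
have mcL (q : T -> R) : measurable_fun setT q ->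
    measurable_fun setT (fun t => (Delta / 16)%:E * (prodn q t)%:E)%E.
  by move=> mq; apply: emeasurable_funM => //; apply/measurable_EFinP; exact: mprodn.
move: key; rewrite ge0_integralD//; last 4 first.
- by move=> t _; rewrite adde_ge0.
- exact: emeasurable_funD.
- by move=> t _; rewrite adde_ge0 ?cL0.
- by apply: emeasurable_funD; exact: mcL.
rewrite ge0_integralD// ge0_integralD//; last 4 first.
- by move=> t _; exact: cL0.
- exact: mcL.
- by move=> t _; exact: cL0.
- exact: mcL.
rewrite !ge0_integralZl//; last 6 first.
- exact/measurable_EFinP.
- by move=> t _; rewrite lee_fin prodn0.
- by rewrite lee_fin divr_ge0.
- exact/measurable_EFinP.
- by move=> t _; rewrite lee_fin prodn0.
- by rewrite lee_fin divr_ge0.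
rewrite (int1 _ _ dP) (int1 _ _ dP') !mule1 -EFinD -leeBlDr//.
apply: le_trans; rewrite -EFinB lee_fin.
have : Delta / 2 * 2^-1 <= Delta / 2 * rho ^+ n by rewrite ler_wpM2l ?divr_ge0.
lra.
Qed.

Definition flip (J : finType) (j : J) (e : {ffun J -> bool}) : {ffun J -> bool} :=
  [ffun i => if i == j then ~~ e i else e i].

Lemma flipK (J : finType) (j : J) : involutive (flip j).
Proof. by move=> e; apply/ffunP => i; rewrite !ffunE; case: eqP; rewrite ?negbK. Qed.

(** Average over all sign vectors: pairing [e] with [flip j e] shows that coordinate [j] costs at
    least Delta/16 on average, so some vector has at least the average total cost. *)
Lemma assouad (J : finType) (P : {ffun J -> bool} -> probability T R)
    (p : {ffun J -> bool} -> T -> R) (n : nat)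
    (theta : {ffun J -> bool} -> J -> R) (est : J -> n.-tuple T -> R)
    (loss : {ffun J -> bool} -> n.-tuple T -> \bar R) (Delta : R) :
  0 <= Delta ->
  (forall e, is_density mu (P e) (p e)) ->
  (forall e j, exists (r : T -> R) (rho : R), [/\ measurable_fun [set: T] r, forall x, 0 <= r x,
    forall x, r x ^+ 2 = p e x * p (flip j e) x,
    (\int[mu]_x (r x)%:E = rho%:E)%E & 2^-1 <= rho ^+ n]) ->
  (forall e j, Delta <= `|theta e j - theta (flip j e) j|) ->
  (forall j, measurable_fun [set: n.-tuple T] (est j)) ->
  (forall e t, ((\sum_j `|theta e j - est j t|)%R%:E <= loss e t)%E) ->
  exists e, ((#|J|%:R * (Delta / 16))%:E <=
    \int[power_measure (P e) n]_t loss e t)%E.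
Proof.
move=> Delta0 dP aff sep mest lossP.
pose D e j t := `|theta e j - est j t|.
have mD e j : measurable_fun [set: n.-tuple T] (D e j).
  by apply: measurableT_comp => //; apply: measurable_funB => //; exact: mest.
pose a e j := (\int[power_measure (P e) n]_t (D e j t)%:E)%E.
have a0 e j : (0 <= a e j)%E by apply: integral_ge0 => t _; rewrite lee_fin /D.
have risk_ge e : (\sum_j a e j <= \int[power_measure (P e) n]_t loss e t)%E.
  rewrite -ge0_integral_sum//; last 2 first.
  - by move=> j; apply/measurable_EFinP; exact: mD.
  - by move=> j t _; rewrite lee_fin /D.
  apply: ge0_le_integral_nonmeas => t; last first.
    by rewrite sumEFin; exact: lossP.
  by apply: sume_ge0 => j _; rewrite lee_fin /D.
have pair e j : ((Delta / 8)%:E <= a e j + a (flip j e) j)%E.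
  have [r [rho [mr r0 r2 rint rhon]]] := aff e j.
  apply: (two_point_lower_bound (dP e) (dP (flip j e)) mr r0 r2 rint rhon) => //.
  - by move=> t; rewrite /D.
  - by move=> t; rewrite /D.
  - move=> t; apply: (le_trans (sep e j)); rewrite /D.
    rewrite (distrC (theta (flip j e) j)); exact: ler_distD.
(* Negating the conclusion makes all coordinate risks finite, so the averaging can be done with real
   numbers. *)
have [//|/forallNP small] := pselect (exists e, ((#|J|%:R * (Delta / 16))%:E <=
    \int[power_measure (P e) n]_t loss e t)%E).
have sma e : (\sum_j a e j < (#|J|%:R * (Delta / 16))%:E)%E.
  by apply: (le_lt_trans (risk_ge e)); rewrite ltNge; exact/negP/small.
have afin e j : a e j \is a fin_num.
  rewrite ge0_fin_numE//; apply: (@le_lt_trans _ _ (\sum_j a e j)%E).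
    by rewrite (bigD1 j)//= leeDl// sume_ge0.
  exact: lt_trans (sma e) (ltry _).
pose b e j := fine (a e j).
have ab e j : a e j = (b e j)%:E by rewrite /b fineK.
have smb e : \sum_j b e j < #|J|%:R * (Delta / 16).
  by rewrite -lte_fin -sumEFin; under eq_bigr do rewrite -ab.
have pairb e j : Delta / 8 <= b e j + b (flip j e) j.
  by rewrite -lee_fin EFinD -!ab.
have avg j : \sum_(e : {ffun J -> bool}) Delta / 16 <= \sum_e b e j.
  (* [flip j] is an involution, so summing the pair bound over all [e] counts every risk twice. *)
  have h : \sum_e b (flip j e) j = \sum_e b e j.
    by rewrite [RHS](reindex_inj (inv_inj (flipK j))).
  have : \sum_(e : {ffun J -> bool}) Delta / 8 <= \sum_e b e j + \sum_e b e j.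
    by rewrite -{2}h -big_split; apply: ler_sum => e _; exact: pairb.
  rewrite !sumr_const -mulr_natl -[in X in _ -> X]mulr_natl.
  lra.
have : \sum_e \sum_j b e j < \sum_(e : {ffun J -> bool}) #|J|%:R * (Delta / 16).
  by apply: ltr_sum => //; apply/hasP; exists [ffun=> true]; rewrite ?mem_index_enum.
rewrite exchange_big /= ltNge => /negP[].
apply: le_trans (ler_sum _ (fun j _ => avg j)).
rewrite exchange_big /=; apply: ler_sum => e _.
by rewrite sumr_const mulr_natl.
Qed.
End two_points.

(** * Lebesgue measure on row vectors *)

Section density.
Context d (T : measurableType d) (R : realType).
Variables (mu : {measure set T -> \bar R}) (f : T -> R).
Hypotheses (mf : measurable_fun [set: T] f) (f0 : forall x, 0 <= f x).
Hypothesis f1 : (\int[mu]_x (f x)%:E = 1)%E.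

Definition density_measure (A : set T) : \bar R :=
  (\int[mu]_(x in A) (f x)%:E)%E.

Let mfE : measurable_fun [set: T] (EFin \o f).
Proof. exact/measurable_EFinP. Qed.

Let density0 : density_measure set0 = 0%E.
Proof. exact: integral_set0. Qed.

Let density_ge0 A : (0 <= density_measure A)%E.
Proof. by apply: integral_ge0 => x _; rewrite lee_fin. Qed.

Let density_sigma_additive : semi_sigma_additive density_measure.
Proof.
move=> F mF tF mUF; rewrite /density_measure ge0_integral_bigcup//.
- by apply: is_cvg_ereal_nneg_natsum_cond => n _ _; exact: density_ge0.
- exact: measurable_funTS.
- by move=> x _; rewrite lee_fin.
Qed.

HB.instance Definition _ := isMeasure.Build _ _ _
  density_measure density0 density_ge0 density_sigma_additive.

Let density_setT : density_measure [set: T] = 1%E.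
Proof. exact: f1. Qed.

HB.instance Definition _ :=
  @Measure_isProbability.Build _ _ R density_measure density_setT.

Lemma exists_probability_density : exists P : probability T R, is_density mu P f.
Proof. by exists density_measure; split. Qed.

End density.

Lemma measurable_fun_rV d d' (X : measurableType d) (T : measurableType d') n
    (f : X -> 'rV[T]_n) :
  (forall i, measurable_fun [set: X] (fun x => f x ord0 i)) ->
  measurable_fun [set: X] f.
Proof.
move=> mf; apply: (@measurability _ _ _ _ _ _
  (\big[setU/set0]_(i < n) preimage_set_system setT
     (fun x : 'rV[T]_n => x ord0 i) measurable)) => //.
move=> _ [A + <-]; rewrite -bigcup_seq/= => -[i _ [B mB <-]].
by rewrite !setTI -[X in measurable X]setTI; exact: mf.
Qed.

Section lebesgue_rV_theory.
Context {R : realType} {d : nat}.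
Local Notation V := 'rV[R]_d.
Local Notation row := (@row_of_tuple R d : d.-tuple (measurableTypeR R) -> V).
Local Notation lpow := (power_measure (@lebesgue_measure R) d).

Lemma measurable_row : measurable_fun [set: d.-tuple (measurableTypeR R)] row.
Proof.
move=> _ A mA; exact: (@measurable_row_of_tuple _ R d measurableT A mA).
Qed.

Lemma integral_lebesgue_rV (g : V -> \bar R) :
  measurable_fun [set: V] g -> (forall x, 0 <= g x)%E ->
  (\int[lebesgue_rV]_x g x = \int[lpow]_t g (row t))%E.
Proof. by move=> mg g0; rewrite (ge0_integral_pushforward measurable_row)//. Qed.

Let tuple_of_row (x : V) : d.-tuple (measurableTypeR R) := [tuple x ord0 i | i < d].

Let measurable_tuple_of_row : measurable_fun [set: V] tuple_of_row.
Proof.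
apply/measurable_fun_tnthP => i; rewrite (_ : _ \o _ = (fun x : V => x ord0 i)).
  exact: measurable_coord.
by apply/funext => x /=; rewrite tnth_mktuple.
Qed.

(** An exhaustion of the tuples is transported along the inverse of [row_of_tuple]. The instance
    makes [integral_density] applicable with Lebesgue measure as reference. *)
Let lebesgue_rV_sigma_finite : sigma_finite [set: V] (@lebesgue_rV R d).
Proof.
have /sigma_finiteP[F [FT _ Foo]] := sigma_finiteT lpow.
exists (fun i => tuple_of_row @^-1` F i).
  by rewrite -preimage_bigcup -FT preimage_setT.
move=> i; have [mF Fioo] := Foo i; split.
  by rewrite -[X in measurable X]setTI; exact: measurable_tuple_of_row.
rewrite /lebesgue_rV /pushforward -comp_preimage (_ : _ \o _ = id)//.
by apply/funext => t; apply: eq_from_tnth => j; rewrite /= tnth_mktuple mxE.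
Qed.

HB.instance Definition _ := Measure_isSigmaFinite.Build _ _ _
  (@lebesgue_rV R d) lebesgue_rV_sigma_finite.

Lemma integral_lebesgue_rV_prod (f : 'I_d -> R -> R) (c : 'I_d -> R) :
  (forall i, measurable_fun [set: R] (f i)) -> (forall i x, 0 <= f i x) ->
  (forall i, \int[lebesgue_measure]_x (f i x)%:E = (c i)%:E)%E ->
  (\int[lebesgue_rV]_x (\prod_(i < d) f i (x ord0 i))%:E = (\prod_(i < d) c i)%:E)%E.
Proof.
move=> mf f0 fc; rewrite integral_lebesgue_rV; last 2 first.
- apply/measurable_EFinP; apply: measurable_prod => i _.
  exact: (measurableT_comp (mf i) (measurable_coord i)).
- by move=> x; rewrite lee_fin prodr_ge0.
rewrite -(integral_power_prod (T := measurableTypeR R) mf f0 fc).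
apply: eq_integral => t _; congr (_%:E).
by apply: eq_bigr => i _; rewrite mxE.
Qed.

Lemma integral_lebesgue_opp (h : R -> \bar R) :
  measurable_fun [set: R] h -> (forall x, 0 <= h x)%E ->
  (\int[@lebesgue_measure R]_x h x = \int[lebesgue_measure]_x h (- x)%R)%E.
Proof.
move=> mh h0.
transitivity (\int[pushforward lebesgue_measure
    (-%R : measurableTypeR R -> measurableTypeR R)]_x h x)%E.
  by apply: eq_measure_integral => A mA _; exact/esym/lebesgue_measureN.
by rewrite ge0_integral_pushforward//=; exact: measurable_funS mh.
Qed.

Lemma integral_lebesgue_rV_opp (g : V -> \bar R) :
  measurable_fun [set: V] g -> (forall x, 0 <= g x)%E ->
  (\int[lebesgue_rV]_x g (- x)%R = \int[lebesgue_rV]_x g x)%E.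
Proof.
move=> mg g0.
have mopp : measurable_fun [set: V] (fun x : V => - x).
  apply: measurable_fun_rV => i; under eq_fun do rewrite mxE.
  by apply: measurableT_comp => //; exact: measurable_coord.
rewrite !integral_lebesgue_rV//; last exact: (measurableT_comp mg mopp).
have mrow : measurable_fun setT (fun t => g (row t)).
  exact: (measurableT_comp mg measurable_row).
rewrite [RHS](integral_power_change (T := measurableTypeR R)
  (T' := measurableTypeR R) (phi := -%R) (f := cst 1) (mu := lebesgue_measure))//.
- apply: eq_integral => t _; rewrite big1_eq mule1; congr g.
  by apply/rowP => i; rewrite !mxE tnth_map.
- by move=> h mh h0; rewrite integral_lebesgue_opp//; apply: eq_integral => x _; rewrite mule1.
Qed.
End lebesgue_rV_theory.

(** * A compactly supported bump *)

Section bump.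
Context {R : realType}.

(** Truncated powers replace a smooth bump: only finitely many derivatives are needed, and these
    remain explicit. *)
Definition pospow (n : nat) (t : R) : R := Num.max 0 t ^+ n.

Lemma pospow_ge0 n t : 0 <= pospow n t.
Proof. by rewrite exprn_ge0// le_max lexx. Qed.

Lemma pospow_pos n t : 0 <= t -> pospow n t = t ^+ n.
Proof. by move=> t0; rewrite /pospow max_r. Qed.

Lemma pospow_neg n t : t <= 0 -> pospow n.+1 t = 0.
Proof. by move=> t0; rewrite /pospow max_l// expr0n. Qed.

Lemma pospowS n t : pospow n.+2 t = t * pospow n.+1 t.
Proof.
have [t0|t0] := leP 0 t; first by rewrite !pospow_pos// exprS.
by rewrite !pospow_neg ?mulr0// ltW.
Qed.

Lemma continuous_pospow n : continuous (pospow n).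
Proof.
move=> t; rewrite /pospow.
have cmax : {for t, continuous (fun t : R => Num.max 0 t)}.
  apply: continuous_max; [exact: cst_continuous|exact: cvg_id].
exact: (continuous_comp cmax (@exprn_continuous R n _)).
Qed.

Lemma is_derive_pospow n (t : R) :
  is_derive t 1 (pospow n.+2) (n.+2%:R * pospow n.+1 t).
Proof.
have [t0|t0|<-] := ltgtP 0 t.
- apply: (@near_eq_is_derive R R R (fun t : R => t ^+ n.+2)).
    near=> y; apply/esym/pospow_pos/ltW.
    by near: y; exact: lt_nbhsr.
  have h := is_deriveX n.+2 (is_derive_id t (1 : R)).
  rewrite pospow_pos ?ltW//; rewrite exprfctE in h; apply: (is_derive_eq h); exact: mulr1.
- apply: (@near_eq_is_derive R R R (fun=> 0)).
    near=> y; apply/esym/pospow_neg/ltW.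
    by near: y; exact: lt_nbhsl.
  rewrite pospow_neg ?mulr0 1?ltW//; exact: is_derive_cst.
- rewrite pospow_neg// mulr0.
  (* At the junction the difference quotient is [pospow n.+1 h], which tends to 0 because its
     exponent is still positive. *)
  have cv : (fun h : R => h^-1 *: (pospow n.+2 (h *: (1 : R) + 0) - pospow n.+2 0))
      @ 0^' --> (0 : R).
    have : pospow n.+1 h @[h --> (0:R)^'] --> (0:R).
      rewrite -[X in _ --> X](@pospow_neg n 0)//.
      by have /continuous_withinNx := @continuous_pospow n.+1 0.
    apply: cvg_trans; apply: near_eq_cvg; near=> h.
    have h0 : h != 0 by near: h; exact: nbhs_dnbhs_neq.
    by rewrite (@pospow_neg n.+1 0)// subr0 addr0 /= [_ *: 1]mulr1 pospowS [RHS]mulrA mulVf// mul1r.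
  split; last exact/cvg_lim.
  by apply/cvg_ex; exists 0.
Unshelve. all: by end_near. Qed.
(** A family closed under differentiation: writing one truncated power as [1 - t ^+ 2] times the
    next lower one, the derivative is again a polynomial times a truncated power, of exponent one
    less. *)
Definition pbump (q : {poly R}) (n : nat) (t : R) : R :=
  q.[t] * pospow n (1 - t ^+ 2).

Lemma is_derive_pbump (q : {poly R}) n (t : R) :
  is_derive t 1 (pbump q n.+2)
    (pbump (q^`() * (1 - 'X^2) - (n.+2 * 2)%:R *: ('X * q)) n.+1 t).
Proof.
have dq := is_derive_poly q t.
have dsq : is_derive t 1 (fun t : R => 1 - t ^+ 2) (- (2 * t)).
  have dX := is_deriveX 2 (is_derive_id t (1 : R)); rewrite exprfctE in dX.
  apply: (is_derive_eq (is_deriveB (is_derive_cst (1 : R) t 1) dX)).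
  by rewrite sub0r [_ *: _]mulr1 expr1.
have dp := is_derive1_comp (g := fun t : R => 1 - t ^+ 2) (is_derive_pospow n (1 - t ^+ 2)) dsq.
apply: (is_derive_eq (is_deriveM dq dp)).
rewrite /pbump /= /GRing.scale /= !hornerE /= pospowS natrM.
ring.
Qed.

Lemma pbump_supp q n t : 1 <= `|t| -> pbump q n.+1 t = 0.
Proof.
move=> t1; rewrite /pbump pospow_neg ?mulr0// subr_le0.
by rewrite -(real_normK (num_real t)) expr_ge1.
Qed.

Lemma pbump_bounded q n : exists C, forall t, `|pbump q n.+1 t| <= C.
Proof.
exists (\sum_(i < size q) `|q`_i|) => t.
have [t1|t1] := leP 1 `|t|.
  by rewrite pbump_supp// normr0 sumr_ge0.
rewrite /pbump normrM; have pos1 : `|pospow n.+1 (1 - t ^+ 2)| <= 1.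
  rewrite ger0_norm ?pospow_ge0// /pospow exprn_ile1 ?le_max ?lexx//.
  by rewrite ge_max ler01 gerBl sqr_ge0.
apply: (@le_trans _ _ `|q.[t]|); first by rewrite ler_piMr.
rewrite horner_coef; apply: (le_trans (ler_norm_sum _ _ _)); apply: ler_sum => i _.
by rewrite normrM ler_piMr// normrX exprn_ile1// ltW.
Qed.

(** Each derivative costs one power. Starting from [B.+2], one power is left after [B.+1]
    derivatives, which keeps them bounded and supported in [-1, 1]; order [B.+1] controls the
    Lipschitz constant at order [B]. *)
Lemma pbump_iter_derive B (q : {poly R}) :
  exists phi : nat -> R -> R, [/\ phi 0 = pbump q B.+2,
    forall k (t : R), (k <= B)%N -> is_derive t 1 (phi k) (phi k.+1 t) &
    forall k, (k <= B.+1)%N -> exists q' m, phi k = pbump q' m.+1].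
Proof.
elim: B q => [|B IH] q.
  exists (fun k => if k is 0 then pbump q 2 else
    pbump (q^`() * (1 - 'X^2) - (2 * 2)%:R *: ('X * q)) 1); split => //.
    by move=> [|//] t _; exact: is_derive_pbump.
  by move=> [|k] _; do 2 eexists; reflexivity.
have [phi [phi0 dphi phiE]] :=
  IH (q^`() * (1 - 'X^2) - (B.+3 * 2)%:R *: ('X * q)).
exists (fun k => if k is k'.+1 then phi k' else pbump q B.+3); split => //.
  move=> [|k] t kB; last exact: dphi.
  by rewrite phi0; exact: is_derive_pbump.
by move=> [|k] kB; [do 2 eexists; reflexivity|exact: phiE].
Qed.

(** The function itself is kept in closed form, since its sign, parity and size near 0 are read off
    from it; of the derivatives only the bound and the support matter. *)
Lemma exists_bump B : exists (phi : nat -> R -> R) (C : R),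
  [/\ 1 <= C, phi 0 = (fun t => pospow B.+2 (1 - t ^+ 2)),
    forall k (t : R), (k <= B)%N -> is_derive t 1 (phi k) (phi k.+1 t),
    forall k t, (k <= B.+1)%N -> `|phi k t| <= C &
    forall k t, (k <= B.+1)%N -> 1 <= `|t| -> phi k t = 0].
Proof.
have [phi [phi0 dphi phiE]] := pbump_iter_derive B 1.
have bnd (k : 'I_B.+2) : exists C, forall t, `|phi k t| <= C.
  by have [q [m ->]] := phiE k (ltn_ord k); exact: pbump_bounded.
have [C HC] := choice bnd.
exists phi, (1 + \sum_k `|C k|); split => //.
- by rewrite lerDl sumr_ge0.
- by rewrite phi0; apply/funext => t; rewrite /pbump -polyC1 hornerC mul1r.
- move=> k t kB; apply: (le_trans (HC (Ordinal (kB : (k < B.+2)%N)) t)).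
  rewrite (bigD1 (Ordinal (kB : (k < B.+2)%N)))//= addrCA (le_trans (ler_norm _))//.
  by rewrite lerDl addr_ge0// sumr_ge0.
- by move=> k t kB t1; have [q [m ->]] := phiE k kB; exact: pbump_supp.
Qed.

End bump.

(** * Sums of disjoint bumps *)

Section directional.
Context {R : realType} {V : normedModType R}.

(** The two difference quotients coincide. Directional derivatives are thereby computed with the
    one-variable chain rule or by differentiating a polynomial. *)
Lemma is_derive_line (f : V -> R) (x v : V) (df : R) :
  is_derive (0 : R) (1 : R) (fun s : R => f (s *: v + x)) df -> is_derive x v f df.
Proof.
have E : (fun h : R => h^-1 *: ((f \o shift x) (h *: v) - f x)) =
    (fun h : R => h^-1 *: (((fun s : R => f (s *: v + x)) \o shift 0) (h *: (1 : R)) -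
      f (0 *: v + x))).
  by apply/funext => h /=; rewrite addr0 scale0r add0r [_ *: (1 : R)]mulr1.
move=> [dg eg]; split.
  by rewrite /derivable E.
by rewrite /derive E.
Qed.

Lemma is_derive_bigsum (W : normedModType R) (I : Type) (r : seq I)
    (f : I -> W -> R) (df : I -> R) (x v : W) :
  (forall i, is_derive x v (f i) (df i)) ->
  is_derive x v (fun z => \sum_(i <- r) f i z) (\sum_(i <- r) df i).
Proof.
move=> H; elim: r => [|i r IH].
  rewrite big_nil (_ : (fun _ => _) = cst 0); first exact: is_derive_cst.
  by apply/funext => z; rewrite big_nil.
rewrite big_cons (_ : (fun _ => _) = f i + (fun z => \sum_(i <- r) f i z)).
  exact: is_deriveD.
by apply/funext => z; rewrite big_cons.
Qed.

End directional.

Lemma continuous_bigprod (R : realType) (W : topologicalType) (I : Type) (r : seq I)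
    (F : I -> W -> R) : (forall i, continuous (F i)) ->
  continuous (fun x => \prod_(i <- r) F i x).
Proof.
move=> cF; elim: r => [|i r IH] x.
  by under eq_fun do rewrite big_nil; exact: cvg_cst.
under eq_fun do rewrite big_cons.
by apply: cvgM; [exact: cF|exact: IH].
Qed.

Lemma continuous_bigsum (R : realType) (W : topologicalType) (I : Type) (r : seq I)
    (F : I -> W -> R) : (forall i, continuous (F i)) ->
  continuous (fun x => \sum_(i <- r) F i x).
Proof.
move=> cF; elim: r => [|i r IH] x.
  by under eq_fun do rewrite big_nil; exact: cvg_cst.
under eq_fun do rewrite big_cons.
by apply: cvgD; [exact: cF|exact: IH].
Qed.

(** * Lipschitz and Hölder inequalities *)

Section misc_ineq.
Context {R : realType}.

(** Telescoping, one factor at a time; [1 <= C] absorbs the missing factor in each term. *)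
Lemma prod_lipschitz (n : nat) (a b : 'I_n -> R) (C delta : R) :
  1 <= C -> 0 <= delta -> (forall i, `|a i| <= C) -> (forall i, `|b i| <= C) ->
  (forall i, `|a i - b i| <= delta) ->
  `|\prod_i a i - \prod_i b i| <= n%:R * C ^+ n * delta.
Proof.
move=> C1 d0; have C0 : 0 <= C by lra.
elim: n a b => [|n IH] a b aC bC ab.
  by rewrite !big_ord0 subrr normr0 !mul0r.
rewrite !big_ord_recl.
set A := \prod_(i < n) _; set A' := \prod_(i < n) _.
have -> : a ord0 * A - b ord0 * A' = a ord0 * (A - A') + (a ord0 - b ord0) * A' by ring.
apply: (le_trans (ler_normD _ _)); rewrite !normrM.
have A'C : `|A'| <= C ^+ n.
  rewrite normr_prod -[X in C ^+ X]card_ord -prodr_const.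
  by apply: ler_prod => i _; rewrite normr_ge0/=.
have h1 : `|a ord0| * `|A - A'| <= C * (n%:R * C ^+ n * delta).
  by apply: ler_pM => //; apply: IH.
have h2 : `|a ord0 - b ord0| * `|A'| <= delta * C ^+ n by exact: ler_pM.
apply: (le_trans (lerD h1 h2)).
have h3 : delta * C ^+ n <= delta * C ^+ n.+1.
  by rewrite ler_wpM2l// exprS ler_peMl// exprn_ge0.
rewrite -natr1 exprS; rewrite exprS in h3; lra.
Qed.

(** For an exponent in [0, 1], min(1, r) is at most r^alpha: the Lipschitz bound serves for r <= 1
    and the uniform bound for r > 1. *)
Lemma holder_interpolation (X M r alpha : R) :
  0 <= alpha -> alpha <= 1 -> 0 < r -> 0 <= M -> X <= M -> X <= M * r ->
  X <= M * r `^ alpha.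
Proof.
move=> a0 a1 r0 M0 XM XMr; have [r1|r1] := leP r 1.
  apply: (le_trans XMr); rewrite ler_wpM2l//.
  by apply: ger1_powR; rewrite ?r0.
apply: (le_trans XM); rewrite ler_peMr//.
by rewrite -(powRr0 r); apply: ler_powR => //; exact: ltW.
Qed.

Lemma derive_bounded_lipschitz (phi dphi : R -> R) (C : R) (s t : R) :
  (forall t, is_derive t (1 : R) phi (dphi t)) -> (forall t, `|dphi t| <= C) ->
  `|phi s - phi t| <= C * `|s - t|.
Proof.
move=> dp dC.
wlog st : s t / s < t.
  move=> H; have [st|st|->] := ltgtP s t; first exact: H.
    by rewrite distrC (distrC s); exact: H.
  by rewrite !subrr normr0 mulr0.
rewrite distrC (distrC s).
have [//|c _ ->] := @MVT R phi dphi s t st (fun x _ => dp x).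
  apply: continuous_subspaceT => x; apply: differentiable_continuous.
  by apply/derivable1_diffP; have [] := dp x.
by rewrite normrM ler_wpM2r.
Qed.

End misc_ineq.

(** * Derivatives and Hölder norm of a sum of disjoint bumps *)

Section bumps.
Context {R : realType} {d : nat} {K : finType}.
Local Notation V := 'rV[R]_d.
Variables (B : nat) (phi : nat -> R -> R) (C : R).
Hypothesis C1 : 1 <= C.
Hypothesis dphi : forall k (t : R), (k <= B)%N ->
  is_derive t (1 : R) (phi k) (phi k.+1 t).
Hypothesis phiC : forall k t, (k <= B.+1)%N -> `|phi k t| <= C.
Hypothesis phi_supp : forall k t, (k <= B.+1)%N -> 1 <= `|t| -> phi k t = 0.
Variables (h : R) (y : K -> V).
Hypothesis h0 : 0 < h.

(** [kap] is a multi-index: up to the factor h^(-|kap|), this is the partial derivative of that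
    order of the product bump centred at [y k]. *)
Definition cell_term (kap : 'I_d -> nat) (k : K) (x : V) : R :=
  \prod_i phi (kap i) ((x ord0 i - y k ord0 i) / h).

Definition bumps (kap : 'I_d -> nat) (c : K -> R) (x : V) : R :=
  \sum_k c k * cell_term kap k x.

Definition active (k : K) (x : V) : bool :=
  [forall i, `|x ord0 i - y k ord0 i| < h].

Lemma cell_term0 kap k x : (forall i, kap i <= B.+1)%N -> ~~ active k x ->
  cell_term kap k x = 0.
Proof.
move=> kapB /forallPn[i]; rewrite -leNgt => hi.
rewrite /cell_term (bigD1 i)//= phi_supp ?mul0r//.
by rewrite normrM normfV (gtr0_norm h0) ler_pdivlMr// mul1r.
Qed.

Lemma cell_term_bounded kap k x : (forall i, kap i <= B.+1)%N ->
  `|cell_term kap k x| <= C ^+ d.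
Proof.
move=> kapB; rewrite normr_prod -[X in C ^+ X]card_ord -prodr_const.
by apply: ler_prod => i _; rewrite normr_ge0 phiC.
Qed.

Lemma phi_lipschitz k s t : (k <= B)%N -> `|phi k s - phi k t| <= C * `|s - t|.
Proof.
move=> kB; apply: (@derive_bounded_lipschitz _ _ (phi k.+1)) => z.
  exact: dphi.
exact: phiC.
Qed.

Lemma coord_le_enorm (x : V) i : `|x ord0 i| <= enorm x.
Proof.
rewrite -sqrtr_sqr ler_wsqrtr// (bigD1 i)//= lerDl.
by apply: sumr_ge0 => j _; exact: sqr_ge0.
Qed.

Lemma cell_term_lipschitz kap k x x' : (forall i, kap i <= B)%N ->
  `|cell_term kap k x - cell_term kap k x'| <=
    d%:R * C ^+ d * (C * (enorm (x - x') / h)).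
Proof.
move=> kapB; have C0 : 0 <= C by exact: le_trans ler01 C1.
apply: prod_lipschitz => //.
- by rewrite mulr_ge0// divr_ge0 ?sqrtr_ge0// ltW.
- by move=> i; apply: phiC; exact: leqW.
- by move=> i; apply: phiC; exact: leqW.
- move=> i; apply: (le_trans (phi_lipschitz _ _ (kapB i))).
  rewrite ler_wpM2l// (_ : _ - _ = (x ord0 i - x' ord0 i) / h); last by ring.
  rewrite normrM normfV (gtr0_norm h0) ler_wpM2r ?invr_ge0 ?(ltW h0)//.
  by have := coord_le_enorm (x - x') i; rewrite !mxE.
Qed.

Lemma is_derive_cell_term kap k (x : V) i : (forall i, kap i <= B)%N ->
  is_derive x (@basis_vec R d i) (cell_term kap k)
    (h^-1 * cell_term (fun j => kap j + (j == i))%N k x).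
Proof.
move=> kapB; apply: is_derive_line.
have E : (fun s : R => cell_term kap k (s *: @basis_vec R d i + x)) =
    (fun s : R => cst (\prod_(j | j != i) phi (kap j) ((x ord0 j - y k ord0 j) / h)) s *
       (phi (kap i) \o (fun s => (s + (x ord0 i - y k ord0 i)) / h)) s).
  apply/funext => s; rewrite /cell_term (bigD1 i)//= mulrC !mxE !eqxx mulr1 addrA.
  congr (_ * _); apply: eq_bigr => j ji.
  by rewrite !mxE (negbTE ji) andbF mulr0 add0r.
rewrite E; set A := \prod_(j | j != i) _.
have di : is_derive (0 : R) (1 : R) (fun s : R => (s + (x ord0 i - y k ord0 i)) / h) h^-1.
  rewrite (_ : (fun _ => _) = h^-1 \*: (id + cst (x ord0 i - y k ord0 i))).
    apply: (is_derive_eq (is_deriveZ _ (is_deriveD (is_derive_id _ _) (is_derive_cst _ _ _)))).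
    by rewrite addr0; exact: mulr1.
  by apply/funext => s; rewrite mulrC.
have dc := is_derive1_comp (f := phi (kap i)) (dphi _ (kapB i)) di.
apply: (is_derive_eq (is_deriveM (is_derive_cst A (0 : R) (1 : R)) dc)).
rewrite scaler0 addr0 /= add0r /cell_term [in RHS](bigD1 i)//= eqxx addn1.
rewrite (_ : \prod_(j | j != i) _ = A); last first.
  by apply: eq_bigr => j ji; rewrite (negbTE ji) addn0.
rewrite [LHS]/GRing.scale /=; ring.
Qed.

Lemma is_derive_bumps kap c (x : V) i : (forall i, kap i <= B)%N ->
  is_derive x (@basis_vec R d i) (bumps kap c)
    (h^-1 * bumps (fun j => kap j + (j == i))%N c x).
Proof.
move=> kapB; rewrite /bumps mulr_sumr.
apply: (is_derive_eq (is_derive_bigsum _ _)).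
  move=> k; apply: is_deriveZ; exact: is_derive_cell_term.
by apply: eq_bigr => k _; rewrite [LHS]/GRing.scale /=; ring.
Qed.

Lemma iter_partial_bumps (s : seq 'I_d) c : (size s <= B.+1)%N ->
  iter_partial s (bumps (fun=> 0%N) c) =
    (fun x => h^-1 ^+ size s * bumps (fun i => count_mem i s) c x).
Proof.
elim: s => [_|i s IH sB]; first by apply/funext => x; rewrite /= mul1r.
rewrite -[LHS]/('D_(@basis_vec R d i) (iter_partial s _)).
rewrite IH; last exact: ltnW.
apply/funext => x.
have kapB j : (count_mem j s <= B)%N by apply: leq_trans (count_size _ _) _; exact: sB.
have [_ /= ->] := is_deriveZ (h^-1 ^+ size s) (is_derive_bumps c x i kapB).
rewrite [LHS]/GRing.scale /= exprSr mulrA; congr (_ * bumps _ _ _).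
by apply/funext => j; rewrite addnC eq_sym.
Qed.

Lemma phi_continuous k : (k <= B)%N -> continuous (phi k).
Proof.
move=> kB t; apply: differentiable_continuous.
by apply/derivable1_diffP; have [] := dphi t kB.
Qed.

Lemma continuous_cell_term kap k : (forall i, kap i <= B)%N ->
  continuous (cell_term kap k).
Proof.
move=> kapB; apply: continuous_bigprod => i x.
have cc : (fun x : V => x ord0 i) @ x --> x ord0 i by exact: coord_continuous.
have ci : {for x, continuous (fun x : V => (x ord0 i - y k ord0 i) / h)}.
  exact: cvgM (cvgB cc (cvg_cst _)) (cvg_cst _).
have cp := @phi_continuous _ (kapB i) ((x ord0 i - y k ord0 i) / h).
exact: (continuous_comp ci cp).
Qed.

Lemma continuous_bumps kap c : (forall i, kap i <= B)%N ->
  continuous (bumps kap c).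
Proof.
move=> kapB; apply: continuous_bigsum => k x.
exact: cvgM (cvg_cst _) (@continuous_cell_term kap k kapB x).
Qed.

Hypothesis y_sep : forall k l, k != l -> exists i,
  2 * h <= `|y k ord0 i - y l ord0 i|.

Lemma active_unique k l x : active k x -> active l x -> k = l.
Proof.
move=> /forallP ak /forallP al; apply/eqP/negPn/negP => /y_sep[i].
rewrite leNgt => /negP; apply; have := ltrD (ak i) (al i).
rewrite (distrC (x ord0 i) (y k ord0 i)) => /(le_lt_trans (ler_distD _ _ _)).
by rewrite mulr2n mulrDl mul1r.
Qed.

(** At most one cell contains [x]. The option turns this into a bound of sums over cells by a single
    indicator, through [sum_option_eq]. *)
Lemma active_option x : exists o, forall k, active k x -> Some k = o.
Proof.
exists [pick k | active k x] => k ak; case: pickP => [l al|/(_ k)].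
  by congr Some; exact: active_unique al.
by rewrite ak.
Qed.

Lemma sum_option_eq (o : option K) (M : R) : 0 <= M ->
  \sum_k M * (Some k == o)%:R <= M.
Proof.
move=> M0; case: o => [k|]; last by rewrite big1// => k _; rewrite mulr0.
rewrite (bigD1 k)//= eqxx mulr1 big1 ?addr0// => l lk.
by rewrite (_ : _ == _ = false) ?mulr0//; apply/eqP => -[] /eqP; rewrite (negbTE lk).
Qed.

Lemma bumps_bounded kap c A x : 0 <= A -> (forall k, `|c k| <= A) ->
  (forall i, kap i <= B.+1)%N -> `|bumps kap c x| <= A * C ^+ d.
Proof.
move=> A0 cA kapB; have C0 : 0 <= C by exact: le_trans ler01 C1.
have [w ao] := active_option x.
apply: le_trans (sum_option_eq w _); last by rewrite mulr_ge0// exprn_ge0.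
apply: (le_trans (ler_norm_sum _ _ _)); apply: ler_sum => k _.
have [/ao ->|nak] := boolP (active k x).
  by rewrite eqxx mulr1 normrM ler_pM ?normr_ge0// cell_term_bounded.
by rewrite cell_term0// mulr0 normr0 !mulr_ge0// exprn_ge0.
Qed.

(** Only the cell of [x] and the cell of [x'] contribute, hence a factor 2 whatever the number of
    cells. *)
Lemma bumps_lipschitz kap c A x x' : 0 <= A -> (forall k, `|c k| <= A) ->
  (forall i, kap i <= B)%N ->
  `|bumps kap c x - bumps kap c x'| <=
    A * (2 * (d%:R * C ^+ d * (C * (enorm (x - x') / h)))).
Proof.
move=> A0 cA kapB; have C0 : 0 <= C by exact: le_trans ler01 C1.
have [w ao] := active_option x; have [w' ao'] := active_option x'.
set L := d%:R * C ^+ d * _.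
have L0 : 0 <= L.
  by rewrite /L !mulr_ge0 ?exprn_ge0 ?divr_ge0 ?sqrtr_ge0 ?invr_ge0 ?(ltW h0)// C0.
have AL0 : 0 <= A * L by exact: mulr_ge0.
apply: (@le_trans _ _ (\sum_k (A * L * (Some k == w)%:R + A * L * (Some k == w')%:R))).
  rewrite /bumps -sumrB; apply: (le_trans (ler_norm_sum _ _ _)); apply: ler_sum => k _.
  rewrite -mulrBr normrM.
  have kle : `|c k| * `|cell_term kap k x - cell_term kap k x'| <= A * L.
    by apply: ler_pM; rewrite ?normr_ge0 ?cA//; exact: cell_term_lipschitz.
  have [/ao ok|nak] := boolP (active k x).
    apply: (le_trans kle); rewrite ok eqxx mulr1 lerDl mulr_ge0//.
  have [/ao' ok|nak'] := boolP (active k x').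
    by apply: (le_trans kle); rewrite ok eqxx mulr1 lerDr mulr_ge0.
  have kapB' i : (kap i <= B.+1)%N by exact: leqW.
  by rewrite !cell_term0// subrr normr0 mulr0 addr_ge0// mulr_ge0.
rewrite big_split /=.
rewrite [leRHS]mulrCA mulr_natl mulr2n; apply: lerD; exact: sum_option_eq.
Qed.

(** Dominates both twice the uniform bound of a cell and, at scale [h], the Lipschitz constant of a
    sum of bumps; this is the form required by [holder_interpolation]. *)
Definition holder_cst : R := 2 * (d.+1%:R * C ^+ d.+1).

Lemma holder_cst_ge : 2 * C ^+ d <= holder_cst /\
  2 * (d%:R * C ^+ d * C) <= holder_cst.
Proof.
have C0 : 0 <= C by exact: le_trans ler01 C1.
have Cd0 : 0 <= C ^+ d by exact: exprn_ge0.
have CdS : C ^+ d <= C ^+ d * C by rewrite ler_peMr.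
rewrite /holder_cst exprSr -natr1; split; rewrite ler_pM2l//.
  have : 0 <= d%:R * (C ^+ d * C) by rewrite !mulr_ge0.
  by lra.
have : 0 <= C ^+ d * C by exact: mulr_ge0.
by lra.
Qed.

Lemma enorm_gt0 (x : V) : x != 0 -> 0 < enorm x.
Proof.
move=> x0; have [i xi] : exists i, x ord0 i != 0.
  apply/existsP; apply: contraNT x0 => /existsPn H; apply/eqP/rowP => i.
  by rewrite mxE; apply/eqP/negPn.
by apply: lt_le_trans (coord_le_enorm x i); rewrite normr_gt0.
Qed.

Lemma bumps_holder kap c A alpha x x' : 0 <= A -> (forall k, `|c k| <= A) ->
  (forall i, kap i <= B)%N -> 0 <= alpha -> alpha <= 1 -> x != x' ->
  `|bumps kap c x - bumps kap c x'| <=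
    A * holder_cst * (enorm (x - x') / h) `^ alpha.
Proof.
move=> A0 cA kapB a0 a1 xx'; have C0 : 0 <= C by exact: le_trans ler01 C1.
have r0 : 0 < enorm (x - x') / h by rewrite divr_gt0// enorm_gt0// subr_eq0.
have M0 : 0 <= holder_cst.
  by apply: le_trans holder_cst_ge.1; rewrite mulr_ge0// exprn_ge0.
have kapB' i : (kap i <= B.+1)%N by exact: leqW.
apply: holder_interpolation => //; first exact: mulr_ge0.
- apply: (le_trans (ler_normB _ _)).
  apply: (le_trans (lerD (bumps_bounded x A0 cA kapB') (bumps_bounded x' A0 cA kapB'))).
  by have := ler_wpM2l A0 holder_cst_ge.1; lra.
- apply: (le_trans (bumps_lipschitz x x' A0 cA kapB)).
  have := ler_wpM2r (mulr_ge0 A0 (ltW r0)) holder_cst_ge.2; lra.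
Qed.

Lemma size_mpartial k (nu : @mindex d k) :
  size (flatten [seq nseq (nu j) j | j <- enum 'I_d]) = mlength nu.
Proof.
rewrite size_flatten /shape -map_comp sumnE big_map big_enum /=.
by apply: eq_bigr => i _; rewrite size_nseq.
Qed.

Lemma mpartial_bumps k (nu : @mindex d k) c : (mlength nu <= B.+1)%N ->
  mpartial nu (bumps (fun=> 0%N) c) =
    (fun x => h^-1 ^+ mlength nu * bumps (fun i => count_mem i
      (flatten [seq nseq (nu j) j | j <- enum 'I_d])) c x).
Proof.
by move=> nuB; rewrite /mpartial iter_partial_bumps size_mpartial.
Qed.

Hypothesis h1 : h <= 1.

Lemma Loo_norm_le (g : V -> R) (M : R) : 0 <= M -> (forall x, `|g x| <= M) ->
  (Loo_norm setT g <= M%:E)%E.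
Proof.
(* The norm is defined by cases and is 0 in the second one, where [0 <= M] is enough. *)
move=> M0 gM; rewrite /Loo_norm unlock; case: ifP => _; last by rewrite lee_fin.
apply/ess_supP; apply: nearW => x /=.
by rewrite patchE in_setT /= lee_fin.
Qed.

(** The height h^beta is chosen for this: a derivative of order m <= beta has size h^(beta - m) <=
    1, and in the top-order seminorm the powers of [h] cancel exactly. *)
Lemma bumps_holder_ball (beta kappa : R) c : B = Num.truncn beta -> 0 <= beta ->
  0 <= kappa -> (forall k, `|c k| <= kappa * h `^ beta) ->
  class_C B setT (bumps (fun=> 0%N) c) /\
  (holder_norm beta setT (bumps (fun=> 0%N) c) <=
    (2 * #|{: @mindex d B}|%:R * (kappa * holder_cst))%:E)%E.
Proof.
move=> BE beta0 kappa0 cA; have C0 : 0 <= C by exact: le_trans ler01 C1.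
have A0 : 0 <= kappa * h `^ beta by rewrite mulr_ge0// powR_ge0.
have /andP[Bbeta betaB] : B%:R <= beta < B.+1%:R by rewrite BE truncn_itv.
have M0 : 0 <= holder_cst.
  by apply: le_trans holder_cst_ge.1; rewrite mulr_ge0// exprn_ge0.
split.
  move=> s x sB _; rewrite iter_partial_bumps; last exact: leqW.
  have cB i : (count_mem i s <= B)%N := leq_trans (count_size _ _) sB.
  split.
    exact: cvgM (cvg_cst _) (@continuous_bumps _ c cB x).
  move=> sB' i; have [+ _] := is_deriveZ (h^-1 ^+ size s) (is_derive_bumps c x i cB).
  by [].
rewrite /holder_norm -BE.
have hpow m : (m <= B)%N -> h^-1 ^+ m * (kappa * h `^ beta) = kappa * h `^ (beta - m%:R).
  move=> mB; rewrite mulrCA powRB ?(gt_eqF h0) ?implybT// powR_mulrn ?ltW// exprVn.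
  by rewrite (mulrC (_ `^ _)).
have hle1 m : (m <= B)%N -> h `^ (beta - m%:R) <= 1.
  move=> mB; rewrite -[leRHS](powRr0 h) ger_powR ?h0//.
  by rewrite subr_ge0; apply: le_trans Bbeta; rewrite ler_nat.
have bound : (forall nu : @mindex d B, (mlength nu <= B)%N ->
    (Loo_norm setT (mpartial nu (bumps (fun=> 0%N) c)) <= (kappa * holder_cst)%:E)%E).
  move=> nu nuB; apply: Loo_norm_le => [|x]; first exact: mulr_ge0.
  rewrite mpartial_bumps; last exact: leqW.
  rewrite normrM ger0_norm ?exprn_ge0 ?invr_ge0 ?(ltW h0)//.
  have kB i : (count_mem i (flatten [seq nseq (nu j) j | j <- enum 'I_d]) <= B.+1)%N.
    by apply: leq_trans (count_size _ _) _; rewrite size_mpartial leqW.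
  have hm0 : 0 <= h^-1 ^+ mlength nu by rewrite exprn_ge0// invr_ge0 ltW.
  apply: (le_trans (ler_wpM2l hm0 (bumps_bounded x A0 cA kB))).
  rewrite mulrA hpow// -mulrA ler_wpM2l//.
  have h2 : h `^ (beta - (mlength nu)%:R) * C ^+ d <= 1 * C ^+ d.
    by apply: ler_wpM2r; [exact: exprn_ge0|exact: hle1].
  have h3 := holder_cst_ge.1; have h4 : 0 <= C ^+ d by exact: exprn_ge0.
  lra.
have hold : (forall nu : @mindex d B, mlength nu == B ->
    (holder_seminorm (beta - B%:R) setT (mpartial nu (bumps (fun=> 0%N) c)) <=
      (kappa * holder_cst)%:E)%E).
  move=> nu /eqP nuB; apply/ereal_supP => _ [[x x'] [_ _ /= xx'] <-]; rewrite lee_fin.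
  have e0 : 0 < enorm (x - x') by rewrite enorm_gt0// subr_eq0.
  rewrite ler_pdivrMr ?powR_gt0// mpartial_bumps ?nuB; last exact: leqW.
  rewrite -mulrBr normrM ger0_norm ?exprn_ge0 ?invr_ge0 ?(ltW h0)//.
  have kB i : (count_mem i (flatten [seq nseq (nu j) j | j <- enum 'I_d]) <= B)%N.
    by apply: leq_trans (count_size _ _) _; rewrite size_mpartial nuB.
  have a0 : 0 <= beta - B%:R by rewrite subr_ge0.
  have a1 : beta - B%:R <= 1 by rewrite lerBlDl natr1 ltW.
  have hm0 : 0 <= h^-1 ^+ B by rewrite exprn_ge0// invr_ge0 ltW.
  apply: (le_trans (ler_wpM2l hm0 (bumps_holder A0 cA kB a0 a1 xx'))).
  rewrite [leLHS](_ : _ = h^-1 ^+ B * (kappa * h `^ beta) *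
    (holder_cst * (enorm (x - x') / h) `^ (beta - B%:R))); last by ring.
  rewrite hpow// powRM ?(ltW e0) ?invr_ge0 ?(ltW h0)//.
  rewrite -powR_inv1 ?(ltW h0)// -powRrM mulN1r powRN.
  have hb : h `^ (beta - B%:R) != 0 by rewrite gt_eqF// powR_gt0.
  rewrite le_eqVlt; apply/orP; left; apply/eqP; field.
  exact: hb.
(* Both sums are extended to all multi-indices, whence the factor 2 and the cardinal in the
   bound. *)
apply: (@le_trans _ _ (\sum_(nu : @mindex d B) (kappa * holder_cst)%:E +
    \sum_(nu : @mindex d B) (kappa * holder_cst)%:E)%E).
  have kM0 : (0 <= (kappa * holder_cst)%:E)%E by rewrite lee_fin mulr_ge0.
  by apply: leeD; rewrite [leLHS]big_mkcond /=; apply: lee_sum => nu _;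
    case: ifP => // nuB; [exact: bound|exact: hold].
rewrite !sumEFin -EFinD lee_fin sumr_const -mulr_natl; lra.
Qed.

End bumps.

(** * The quadratic potential *)

Section quadratic.
Context {R : realType} {d : nat}.
Local Notation V := 'rV[R]_d.
Variable m : R.

Definition dotp (x y : V) : R := \sum_i x ord0 i * y ord0 i.

Definition quad (x : V) : R := dotp x x / 2 + m.

Lemma dotpC x y : dotp x y = dotp y x.
Proof. by apply: eq_bigr => i _; rewrite mulrC. Qed.

Lemma dotpDl x y z : dotp (x + y) z = dotp x z + dotp y z.
Proof. by rewrite /dotp -big_split; apply: eq_bigr => i _; rewrite !mxE mulrDl. Qed.

Lemma dotpDr x y z : dotp x (y + z) = dotp x y + dotp x z.
Proof. by rewrite dotpC dotpDl !(dotpC x). Qed.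

Lemma dotpZl a x y : dotp (a *: x) y = a * dotp x y.
Proof. by rewrite /dotp mulr_sumr; apply: eq_bigr => i _; rewrite !mxE mulrA. Qed.

Lemma dotpZr a x y : dotp x (a *: y) = a * dotp x y.
Proof. by rewrite dotpC dotpZl dotpC. Qed.

Lemma dotp_basisl i x : dotp (basis_vec i) x = x ord0 i.
Proof.
rewrite /dotp (bigD1 i)//= big1 ?addr0 ?mxE ?eqxx ?mul1r// => j ji.
by rewrite !mxE (negbTE ji) andbF mul0r.
Qed.

Lemma enormE x : enorm x = Num.sqrt (dotp x x).
Proof. by congr Num.sqrt; apply: eq_bigr => i _; rewrite expr2. Qed.

Lemma dotp_ge0 x : 0 <= dotp x x.
Proof. by apply: sumr_ge0 => i _; rewrite -expr2 sqr_ge0. Qed.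

Lemma enorm_sqr x : enorm x ^+ 2 = dotp x x.
Proof. by rewrite enormE sqr_sqrtr// dotp_ge0. Qed.

Lemma enorm_ge0 (x : V) : 0 <= enorm x.
Proof. exact: sqrtr_ge0. Qed.

(** Cauchy-Schwarz, from the nonnegative square of the component of [x] orthogonal to [y], scaled by
    [dotp y y] to avoid a division. *)
Lemma dotp_le_enorm x y : `|dotp x y| <= enorm x * enorm y.
Proof.
rewrite -(@ler_pXn2r _ 2)// ?nnegrE ?mulr_ge0 ?enorm_ge0//.
rewrite exprMn !enorm_sqr real_normK ?num_real//.
have [y0|y0] := eqVneq (dotp y y) 0.
  have y00 i : y ord0 i = 0.
    have /eqP := y0; rewrite psumr_eq0 => [/allP/(_ i)|j _]; last by rewrite -expr2 sqr_ge0.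
    by rewrite mem_index_enum mulf_eq0 orbb => /(_ isT)/eqP.
  have -> : dotp x y = 0 by apply: big1 => i _; rewrite y00 mulr0.
  by rewrite expr0n/= mulr_ge0 ?dotp_ge0.
have y1 : 0 < dotp y y by rewrite lt_def y0 dotp_ge0.
have := dotp_ge0 (dotp y y *: x - dotp x y *: y).
have -> : dotp (dotp y y *: x - dotp x y *: y) (dotp y y *: x - dotp x y *: y) =
    dotp y y * (dotp x x * dotp y y - dotp x y ^+ 2).
  by rewrite -scaleN1r scalerA !(dotpDl, dotpDr, dotpZl, dotpZr) (dotpC y x); ring.
by rewrite pmulr_rge0// subr_ge0.
Qed.

Lemma is_derive_quad (x v : V) : is_derive x v quad (dotp v x).
Proof.
apply: is_derive_line.
pose p : {poly R} := (dotp v v / 2) *: 'X^2 + dotp v x *: 'X + (quad x)%:P.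
rewrite (_ : (fun _ => _) = horner p).
  apply: (is_derive_eq (is_derive_poly p 0)).
  rewrite /p !poly.derivE mul1r mulr1 !(hornerD, hornerZ, hornerX, hornerC).
  by ring.
apply/funext => s; rewrite /p !(hornerD, hornerZ, hornerXn, hornerX, hornerC, hornerMn) /quad !(dotpDl, dotpDr, dotpZl, dotpZr).
by rewrite (dotpC x v); field.
Qed.

Lemma is_derive_dotp (w x v : V) : is_derive x v (dotp w) (dotp w v).
Proof.
apply: is_derive_line.
pose p : {poly R} := dotp w v *: 'X + (dotp w x)%:P.
rewrite (_ : (fun _ => _) = horner p).
  apply: (is_derive_eq (is_derive_poly p 0)).
  by rewrite /p !poly.derivE !(hornerD, hornerZ, hornerX, hornerC) mulr1 addr0.
by apply/funext => s; rewrite /p !(hornerD, hornerZ, hornerXn, hornerX, hornerC, hornerMn) dotpDr dotpZr mulrC.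
Qed.

Lemma derive_quad v : 'D_v quad = dotp v.
Proof. by apply/funext => x; have [_ ->] := is_derive_quad x v. Qed.

Lemma derive_dotp v w : 'D_v (dotp w) = cst (dotp w v).
Proof. by apply/funext => x; have [_ ->] := is_derive_dotp w x v. Qed.

Lemma derive_cst_fun v (a : R) : 'D_v (cst a : V -> R) = cst 0.
Proof. by apply/funext => x; rewrite derive_cst. Qed.

Lemma iter_derive_quad (hs : seq V) : iter_derive hs quad =
  match hs with
  | [::] => quad
  | [:: v] => dotp v
  | [:: w; v] => cst (dotp v w)
  | _ => cst 0
  end.
Proof.
elim: hs => [//|h hs IH]; rewrite -[LHS]/('D_h (iter_derive hs quad)) IH.
case: hs {IH} => [|v [|w [|z r]]].
- exact: derive_quad.
- exact: derive_dotp.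
- exact: derive_cst_fun.
- exact: derive_cst_fun.
Qed.

Lemma continuous_dotp v : continuous (dotp v).
Proof.
apply: continuous_bigsum => i x.
have cc : (fun x : V => x ord0 i) @ x --> x ord0 i by exact: coord_continuous.
exact: cvgM (cvg_cst _) cc.
Qed.

Lemma continuous_quad : continuous quad.
Proof.
have cd : continuous (fun x : V => dotp x x).
  apply: continuous_bigsum => i x.
  have cc : (fun x : V => x ord0 i) @ x --> x ord0 i by exact: coord_continuous.
  exact: (cvgM cc cc).
by move=> x; exact: cvgD (cvgM (cd x) (cvg_cst _)) (cvg_cst _).
Qed.

Lemma class_C_quad k (S : set V) : class_C k S quad.
Proof.
move=> s x _ _; rewrite /iter_partial iter_derive_quad; split.
  case: (map _ s) => [|v [|w [|z r]]].
  - exact: continuous_quad.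
  - exact: continuous_dotp.
  - exact: cst_continuous.
  - exact: cst_continuous.
move=> _ i; case: (map _ s) => [|v [|w [|z r]]].
- by have [] := is_derive_quad x (basis_vec i).
- by have [] := is_derive_dotp v x (basis_vec i).
- exact: derivable_cst.
- exact: derivable_cst.
Qed.

Lemma hessian_quad x : hessian quad x = 1%:M.
Proof.
apply/matrixP => i j; rewrite mxE /iter_partial iter_derive_quad /=.
by rewrite dotp_basisl !mxE eqxx /= eq_sym.
Qed.

Lemma loewner_le_scalar1 (a : R) : a <= 1 -> loewner_le a%:M (1%:M : 'M[R]_d).
Proof.
move=> a1 h; rewrite mul_mx_scalar mulmx1 -scalemxAl mxE ler_piMl// mxE.
by apply: sumr_ge0 => i _; rewrite mxE -expr2 sqr_ge0.
Qed.

Lemma quad_argmin_le (K : R) x : 0 <= K ->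
  argmin (EFin \o quad) x -> enorm x <= K.
Proof.
move=> K0 /(_ 0); rewrite lee_fin lerD2r.
have -> : dotp 0 0 / 2 = 0 by rewrite /dotp big1 ?mul0r// => i _; rewrite mxE mul0r.
move=> x0; rewrite enormE (_ : dotp x x = 0) ?sqrtr0//.
by apply/eqP; rewrite eq_le dotp_ge0 andbT; lra.
Qed.

Lemma argmin_quad0 : argmin (EFin \o quad) 0.
Proof.
move=> x; rewrite lee_fin lerD2r.
have -> : dotp 0 0 / 2 = 0 by rewrite /dotp big1 ?mul0r// => i _; rewrite mxE mul0r.
by rewrite divr_ge0// dotp_ge0.
Qed.

(** The successive derivatives have norms at most |quad x|, |x|, 1, and then 0. *)
Lemma nabla_norm_quad_le k x (M : R) : 1 <= M -> `|quad x| <= M -> enorm x <= M ->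
  (nabla_norm k quad x <= M%:E)%E.
Proof.
move=> M1 qM xM; have M0 : 0 <= M := le_trans ler01 M1.
apply/ereal_supP => _ [hs /= hs1 <-]; rewrite lee_fin iter_derive_quad.
have {}hs1 v : v \in (hs : seq V) -> enorm v = 1.
  by move=> /tnthP[i ->]; exact: hs1.
case: (hs : seq V) hs1 => [|v [|w [|z r]]] hs1 //=; last by rewrite normr0.
- apply: (le_trans (dotp_le_enorm _ _)).
  by rewrite hs1 ?mul1r// mem_head.
- apply: (le_trans (dotp_le_enorm _ _)).
  by rewrite !hs1 ?mul1r// ?mem_head// !inE eqxx orbT.
Qed.

(** With w = [quad x] the right-hand side is at least 1 + w. As w >= 1, the allowed distance is at
    most 1/w, while |x| + 1/2 <= w; moving to [y] therefore raises the potential by at most 1, and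
    |y| stays below 1 + w. *)
Lemma quad_growth (K : R) x y : 1 <= m -> 1 <= K ->
  enorm (x - y) <= (K * Num.max 1 `|quad x|) `^ (- K) ->
  forall k, (nabla_norm k quad y <= (K * (1 + `|quad x| `^ K))%:E)%E.
Proof.
move=> m1 K1 xy k.
set w := quad x; have wE : w = enorm x ^+ 2 / 2 + m by rewrite enorm_sqr.
have w1 : 1 <= w by rewrite wE; have := sqr_ge0 (enorm x); lra.
have w0 : 0 < w by lra.
rewrite (ger0_norm (ltW w0)) max_r// in xy.
rewrite -/w (ger0_norm (ltW w0)) in xy *.
have wK : w <= w `^ K by exact: le1r_powR.
have bnd : 1 + w <= K * (1 + w `^ K).
  apply: (@le_trans _ _ (1 + w `^ K)); first by rewrite lerD2l.
  by rewrite ler_peMl// addr_ge0 ?powR_ge0.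
set r := enorm x in wE; set e := enorm (x - y) in xy.
have r0 : 0 <= r by exact: enorm_ge0.
have e0 : 0 <= e by exact: enorm_ge0.
have ew : e * w <= 1.
  have Kw1 : 1 <= K * w by rewrite mulr_ege1.
  rewrite powRN in xy; apply: (le_trans (ler_wpM2r (ltW w0) xy)).
  rewrite mulrC ler_pdivrMr ?mul1r ?powR_gt0 ?(lt_le_trans ltr01)//.
  by apply: le_trans (le1r_powR Kw1 K1); rewrite ler_peMl// ltW.
have e1 : e <= 1 by apply: le_trans ew; rewrite ler_peMr.
have rw : r + 2^-1 <= w by have := sqr_ge0 (r - 1); rewrite wE sqrrB; lra.
have xz : `|dotp x (x - y)| <= r * e by exact: dotp_le_enorm.
have yy : dotp y y = r ^+ 2 - 2 * dotp x (x - y) + e ^+ 2.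
  have -> : dotp y y = dotp (x + -1 *: (x - y)) (x + -1 *: (x - y)).
    by rewrite scaleN1r subKr.
  rewrite /r /e !enorm_sqr; move: (x - y) => z.
  by rewrite !(dotpDl, dotpDr, dotpZl, dotpZr) (dotpC z x); ring.
apply: nabla_norm_quad_le.
- by apply: le_trans bnd; rewrite lerDl ltW.
- apply: le_trans bnd.
  rewrite ger0_norm; last by rewrite addr_ge0 ?divr_ge0 ?dotp_ge0//; lra.
  have h1 : e * (r + e / 2) <= e * w by apply: ler_wpM2l => //; lra.
  move: xz; rewrite ler_norml => /andP[xz _].
  by rewrite /quad yy; lra.
- apply: le_trans bnd; apply: (@le_trans _ _ (r + e)); last by lra.
  rewrite -(@ler_pXn2r _ 2)// ?nnegrE ?enorm_ge0 ?addr_ge0// enorm_sqr yy.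
  move: xz; rewrite ler_norml => /andP[xz _].
  by rewrite sqrrD -mulr_natl; lra.
Qed.

End quadratic.

(** * The Gaussian density and the cells *)

(** An exponential never vanishes, so the support is the whole space and the perturbation is
    constrained only through its Hölder norm. *)
Lemma admissible_quad (R : realType) (d : nat) (beta K m : R)
    (p a : 'rV[R]_d -> R) : 1 <= m -> 1 <= K ->
  (forall x, p x = expR (- quad m x + a x)) ->
  class_C (Num.truncn beta) setT a -> (holder_norm beta setT a <= K%:E)%E ->
  admissible beta K p (EFin \o quad m) a.
Proof.
move=> m1 K1 pE aC aK.
have supp : Defs.support p = setT.
  by apply/seteqP; split => // x _; rewrite /Defs.support /= pE gt_eqF// expR_gt0.
have K0 : 0 <= K by exact: le_trans K1.
split.
- by split => [//|x]; rewrite pE.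
- by rewrite supp; split; [split|exact: class_C_quad].
- move=> x _; rewrite hessian_quad; apply: loewner_le_scalar1.
  by rewrite invf_le1// (lt_le_trans ltr01).
- split; first by exists 0; exact: argmin_quad0.
  by move=> x; exact: quad_argmin_le.
- move=> x y _ xy; rewrite supp; split => // k _.
  exact: quad_growth.
Qed.

Section gauss.
Context {R : realType} {d : nat}.
Local Notation V := 'rV[R]_d.

Definition gauss (x : V) : R := \prod_i normal_pdf 0 1 (x ord0 i).

(** This is (d/2) ln(2 pi), the additive constant of the Gaussian potential. *)
Definition gauss_cst : R := - (d%:R * ln (normal_peak (1 : R))).

Lemma normal_pdf01 (t : R) : normal_pdf 0 1 t = normal_peak 1 * expR (- (t ^+ 2 / 2)).
Proof.
by rewrite normal_pdfE ?oner_eq0// /normal_fun subr0 expr1n mulNr.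
Qed.

Lemma normal_peak1_gt0 : 0 < normal_peak (1 : R).
Proof. by rewrite normal_peak_gt0// oner_eq0. Qed.

Lemma normal_peak1_le : normal_peak (1 : R) <= 2^-1.
Proof.
have pi2 := @pi_ge2 R.
rewrite /normal_peak expr1n mul1r lef_pV2 ?posrE ?sqrtr_gt0//; last first.
  by rewrite pmulrn_lgt0// (lt_le_trans _ pi2).
rewrite -[X in X <= _](ger0_norm (ler0n R 2)) -sqrtr_sqr ler_wsqrtr//.
by rewrite mulr2n expr2; lra.
Qed.

Lemma gaussE x : gauss x = expR (- quad gauss_cst x).
Proof.
rewrite /gauss; under eq_bigr do rewrite normal_pdf01 -{1}(lnK normal_peak1_gt0) -expRD.
rewrite -expR_sum; congr expR; rewrite big_split /= sumr_const card_ord.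
rewrite /quad /gauss_cst opprD opprK addrC [d%:R * _]mulr_natl; congr (_ + _).
by rewrite sumrN -mulr_suml; congr (- (_ / _)); apply: eq_bigr => i _; rewrite expr2.
Qed.

Lemma gauss_ge0 x : 0 <= gauss x.
Proof. by rewrite gaussE expR_ge0. Qed.

Lemma gauss_le1 x : gauss x <= 1.
Proof.
rewrite /gauss; apply: prodr_ile1 => i _; rewrite normal_pdf_ge0/=.
apply: (le_trans (normal_pdf_ub _ _ _)); rewrite ?oner_eq0//.
by apply: (le_trans normal_peak1_le); lra.
Qed.

Lemma gauss_opp x : gauss (- x) = gauss x.
Proof. by apply: eq_bigr => i _; rewrite mxE !normal_pdf01 sqrrN. Qed.

(** The value of the density at the corners of [-1, 1]^d, the cube containing all cells. *)
Definition gauss_min : R := (normal_peak 1 * expR (- 2^-1)) ^+ d.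

Lemma gauss_min_gt0 : 0 < gauss_min.
Proof. by rewrite exprn_gt0// mulr_gt0 ?normal_peak1_gt0// expR_gt0. Qed.

Lemma gauss_ge (x : V) : (forall i, `|x ord0 i| <= 1) -> gauss_min <= gauss x.
Proof.
move=> x1; rewrite /gauss_min -[X in _ ^+ X]card_ord -prodr_const.
apply: ler_prod => i _; rewrite mulr_ge0 ?(ltW normal_peak1_gt0) ?expR_ge0//=.
rewrite normal_pdf01 ler_pM2l ?normal_peak1_gt0// ler_expR lerN2.
rewrite ler_pdivrMr// mulVf// -(real_normK (num_real _)).
by rewrite exprn_ile1.
Qed.

Lemma measurable_gauss : measurable_fun [set: V] gauss.
Proof.
apply: measurable_prod => i _.
exact: (measurableT_comp (measurable_normal_pdf _ _) (measurable_coord i)).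
Qed.

Lemma integral_gauss : (\int[lebesgue_rV]_x (gauss x)%:E = 1)%E.
Proof.
rewrite (integral_lebesgue_rV_prod (f := fun=> normal_pdf 0 1) (c := fun=> 1)).
- by rewrite big1_eq.
- by move=> i; exact: measurable_normal_pdf.
- by move=> i x; exact: normal_pdf_ge0.
- by move=> i; exact: integral_normal_pdf.
Qed.

(** The margin 3/2 leaves 1 for [quad_growth] after adding the logarithm of the normalizer, which
    can be as low as -1/2 in the bounds below. *)
Lemma gauss_cst_ge : (3 <= d)%N -> 3 / 2 <= gauss_cst.
Proof.
move=> d3; have lnp : ln (normal_peak (1 : R)) <= - 2^-1.
  have h : normal_peak (1 : R) = 1 + (normal_peak 1 - 1) by ring.
  have := normal_peak1_gt0; have := normal_peak1_le => ? ?.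
  rewrite h; apply: (le_trans (le_ln1Dx _)); lra.
have d3R : 3 <= d%:R :> R by rewrite ler_nat.
have : d%:R / 2 <= d%:R * - ln (normal_peak (1 : R)).
  by rewrite ler_wpM2l// lerNr.
rewrite /gauss_cst mulrN; lra.
Qed.

End gauss.

(** * Size of a single bump *)

Section cells.
Context {R : realType} {d : nat}.
Local Notation V := 'rV[R]_d.
Variables (N : nat) (phi0 : R -> R).
Hypothesis phi0E : phi0 = (fun t => pospow N.+1 (1 - t ^+ 2)).

Lemma phi0_ge0 t : 0 <= phi0 t.
Proof. by rewrite phi0E pospow_ge0. Qed.

Lemma phi0_le1 t : phi0 t <= 1.
Proof.
rewrite phi0E /pospow exprn_ile1 ?le_max ?lexx//.
by rewrite ge_max ler01 gerBl sqr_ge0.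
Qed.

Lemma phi0_opp t : phi0 (- t) = phi0 t.
Proof. by rewrite phi0E sqrrN. Qed.

Lemma phi0_out t : 1 <= `|t| -> phi0 t = 0.
Proof.
move=> t1; rewrite phi0E pospow_neg// subr_le0.
by rewrite -(real_normK (num_real t)) expr_ge1.
Qed.

Lemma phi0_ge t : `|t| <= 2^-1 -> (3 / 4) ^+ N.+1 <= phi0 t.
Proof.
move=> t1; have t2 : t ^+ 2 <= 4^-1.
  rewrite -(real_normK (num_real t)) [leRHS](_ : _ = 2^-1 ^+ 2); last by field.
  by rewrite ler_pXn2r// nnegrE.
rewrite phi0E pospow_pos; last by lra.
by rewrite ler_pXn2r// ?nnegrE; lra.
Qed.

Lemma measurable_phi0 : measurable_fun [set: R] phi0.
Proof.
rewrite phi0E; apply: (measurableT_comp (f := pospow N.+1)).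
  by apply: continuous_measurable_fun; exact: continuous_pospow.
by apply: measurable_funB => //; exact: measurable_funX.
Qed.

Variables (h : R).
Hypothesis h0 : 0 < h.

(** The [cell_term] of order zero, isolated because its sign, parity and energy come from the closed
    form of [phi0] and not from derivative bounds. *)
Definition cell (y x : V) : R := \prod_i phi0 ((x ord0 i - y ord0 i) / h).

Lemma cell_ge0 y x : 0 <= cell y x.
Proof. by apply: prodr_ge0 => i _; exact: phi0_ge0. Qed.

Lemma cell_le1 y x : cell y x <= 1.
Proof. by apply: prodr_ile1 => i _; rewrite phi0_ge0 phi0_le1. Qed.

Lemma cell_opp y x : cell y (- x) = cell (- y) x.
Proof.
by apply: eq_bigr => i _; rewrite !mxE -phi0_opp -mulNr opprD opprK.
Qed.

Lemma measurable_cell y : measurable_fun [set: V] (cell y).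
Proof.
apply: measurable_prod => i _; apply: (measurableT_comp measurable_phi0).
apply: measurable_funM => //; apply: measurable_funB => //.
exact: measurable_coord.
Qed.

Lemma measurable_indic_coord (I : set R) i : measurable I ->
  measurable_fun [set: V] (fun x : V => \1_I (x ord0 i) : R).
Proof.
move=> mI; have m1 : measurable_fun [set: R] (\1_I : R -> R) by exact: measurable_indic.
exact: (measurableT_comp m1 (measurable_coord i)).
Qed.

Lemma integral_indic_ball (y r : R) : 0 <= r ->
  (\int[lebesgue_measure]_x (\1_(`[y - r, y + r]%classic : set R) x)%:E = (2 * r)%:E)%E.
Proof.
move=> r0; rewrite integral_indic// setIT.
apply: (etrans (lebesgue_measure_itv `[y - r, y + r])); rewrite /= lte_fin.
case: ltP => H; first by rewrite -EFinB; congr (_%:E); ring.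
by congr (_%:E); lra.
Qed.

Lemma integral_cell_le y : (\int[lebesgue_rV]_x (cell y x)%:E <= ((2 * h) ^+ d)%:E)%E.
Proof.
pose I i : set R := `[y ord0 i - h, y ord0 i + h]%classic.
have E : (\int[lebesgue_rV]_x (\prod_i \1_(I i) ((x : V) ord0 i))%:E = ((2 * h) ^+ d)%:E)%E.
  rewrite (integral_lebesgue_rV_prod (f := fun i => \1_(I i)) (c := fun=> 2 * h)).
  - by rewrite prodr_const card_ord.
  - by move=> i; exact: (measurable_indic (measurable_itv _)).
  - by move=> i x; rewrite indicE.
  - by move=> i; apply: integral_indic_ball; exact: ltW.
rewrite -E; apply: ge0_le_integral => //.
- by move=> x _; rewrite lee_fin cell_ge0.
- by apply/measurable_EFinP; exact: measurable_cell.
- apply/measurable_EFinP; apply: measurable_prod => i _.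
  exact: measurable_indic_coord (measurable_itv _).
- move=> x _; rewrite lee_fin; apply: ler_prod => i _; rewrite phi0_ge0 /=.
  rewrite indicE; have [_|xI] := boolP (_ \in _); first exact: phi0_le1.
  rewrite phi0_out//; rewrite normrM normfV (gtr0_norm h0) ler_pdivlMr// mul1r leNgt.
  apply: contra xI => xI; rewrite inE /I /= in_itv /= -ler_distlC distrC ltW//.
Qed.

(** On the concentric cube of half the side, of volume h^d, each factor of the bump is at least
    (3/4)^(N+1). *)
Lemma integral_cell_sqr_ge y :
  (((((3 / 4) ^+ N.+1) ^+ 2 * h) ^+ d)%:E <= \int[lebesgue_rV]_x (cell y x ^+ 2)%:E)%E.
Proof.
pose I i : set R := `[y ord0 i - h / 2, y ord0 i + h / 2]%classic.
set c1 := (3 / 4) ^+ N.+1 ^+ 2.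
have c10 : 0 <= c1 by rewrite /c1 sqr_ge0.
have E : (\int[lebesgue_rV]_x (\prod_i (c1 * \1_(I i) ((x : V) ord0 i)))%:E = ((c1 * h) ^+ d)%:E)%E.
  rewrite (integral_lebesgue_rV_prod (f := fun i x => c1 * \1_(I i) x) (c := fun=> c1 * h)).
  - by rewrite prodr_const card_ord.
  - by move=> i; apply: measurable_funM => //; exact: (measurable_indic (measurable_itv _)).
  - by move=> i x; rewrite mulr_ge0// indicE.
  - move=> i; under eq_integral do rewrite EFinM.
    rewrite ge0_integralZl//; last first.
      by apply/measurable_EFinP; exact: (measurable_indic (measurable_itv _)).
    rewrite integral_indic_ball; last by rewrite divr_ge0// ltW.
    by rewrite -EFinM; congr (_%:E); field.
rewrite -E; apply: ge0_le_integral => //.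
- by move=> x _; rewrite lee_fin prodr_ge0// => i _; rewrite mulr_ge0// indicE.
- apply/measurable_EFinP; apply: measurable_prod => i _; apply: measurable_funM => //.
  exact: measurable_indic_coord (measurable_itv _).
- by apply/measurable_EFinP; apply: measurable_funX; exact: measurable_cell.
- move=> x _; rewrite lee_fin /cell -prodrXl; apply: ler_prod => i _.
  rewrite mulr_ge0 ?indicE//=; have [xI|_] := boolP (_ \in _); last by rewrite mulr0 sqr_ge0.
  rewrite mulr1 /c1 ler_pXn2r// ?nnegrE ?phi0_ge0 ?exprn_ge0//; apply: phi0_ge.
  rewrite normrM normfV (gtr0_norm h0) ler_pdivrMr// mulrC.
  by move: xI; rewrite inE /I /= in_itv /= -ler_distlC distrC.
Qed.

End cells.

(** * The hypercube of perturbations *)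

Section hypercube.
Context {R : realType} {d : nat}.
Local Notation V := 'rV[R]_d.
Hypothesis d_gt0 : (0 < d)%N.
Variables (B : nat) (phi : nat -> R -> R).
Hypothesis phi0E : phi 0%N = (fun t => pospow B.+2 (1 - t ^+ 2)).
Variable M : nat.
Hypothesis M_gt0 : (0 < M)%N.

(** [M] intervals of half-length [mesh] tile [0, 1]; the cells tile [0, 1]^d and its mirror
    image. *)
Definition mesh : R := (2 * M%:R)^-1.
Local Notation h := mesh.

Lemma mesh_gt0 : 0 < h.
Proof. by rewrite invr_gt0 mulr_gt0// ltr0n. Qed.

Lemma mesh_le1 : h <= 1.
Proof.
rewrite invf_le1 ?mulr_gt0 ?ltr0n//.
have : 1 <= M%:R :> R by rewrite ler1n.
lra.
Qed.

Definition sg (b : bool) : R := if b then 1 else -1.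

Lemma norm_sg b : `|sg b| = 1.
Proof. by case: b; rewrite /= ?normrN normr1. Qed.

Lemma sgN b : sg (~~ b) = - sg b.
Proof. by case: b; rewrite /= ?opprK. Qed.

Local Notation J := {ffun 'I_d -> 'I_M}.

(* A sign vector is indexed by J; the two cells (j, true) and (j, false) sharing
   the sign of j are exchanged by x |-> -x, which makes the perturbation odd. *)
Definition centre (k : J * bool) : V :=
  \row_i (sg k.2 * ((2 * (k.1 i)%:R + 1) * h)).

Lemma centre_neg j b : - centre (j, b) = centre (j, ~~ b).
Proof. by apply/rowP => i; rewrite !mxE /= sgN mulNr. Qed.

Lemma centre_sep k l : k != l ->
  exists i, 2 * h <= `|centre k ord0 i - centre l ord0 i|.
Proof.
have h0 := mesh_gt0.
case: k => j b; case: l => j' b' kl.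
have [bb|bb] := eqVneq b b'.
  have jj : j != j' by apply: contraNneq kl => ->; rewrite bb.
  have [i ij] : exists i, j i != j' i.
    apply/existsP; apply: contraNT jj => /existsPn H; apply/eqP/ffunP => i.
    by apply/eqP/negPn.
  exists i; rewrite !mxE /= bb -mulrBr normrM norm_sg mul1r -mulrBl normrM (gtr0_norm h0).
  rewrite ler_wpM2r ?(ltW h0)//.
  rewrite (_ : _ - _ = 2 * ((j i)%:R - (j' i)%:R)); last by ring.
  rewrite normrM (ger0_norm (ler0n _ 2)) ler_peMr//.
  wlog lt : j j' ij {kl bb jj} / (j i < j' i)%N.
    move=> H; have := ij; rewrite -(inj_eq val_inj) neq_ltn => /orP[|] lt; first exact: H.
    by rewrite distrC; apply: H => //; rewrite eq_sym.
  rewrite distrC -natrB ?ger0_norm// ?ler0n//; last exact: ltnW.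
  by rewrite ler1n subn_gt0.
(* Centres of opposite signs are separated in every coordinate, and [d_gt0] provides one. *)
exists (Ordinal d_gt0); rewrite !mxE /=.
have -> : b' = ~~ b by move: bb; case: (b); case: (b').
rewrite sgN mulNr opprK -mulrDr normrM norm_sg mul1r -mulrDl ger0_norm; last first.
  by rewrite mulr_ge0 ?(ltW h0)// !addr_ge0// mulr_ge0.
rewrite ler_wpM2r ?(ltW h0)//.
have := ler0n R (j (Ordinal d_gt0)); have := ler0n R (j' (Ordinal d_gt0)); lra.
Qed.

Lemma centre_le1 k (x : V) : active h centre k x -> forall i, `|x ord0 i| <= 1.
Proof.
move=> /forallP ak i; have h0 := mesh_gt0; have := ltW (ak i); rewrite mxE.
set z := (2 * _ + 1) * h => xz.
have z0 : 0 <= z by rewrite mulr_ge0 ?(ltW h0)// addr_ge0// mulr_ge0.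
have zh : z + h <= 1.
  rewrite /z -[X in _ + X <= _]mul1r -mulrDl /mesh ler_pdivrMr ?mulr_gt0 ?ltr0n// mul1r.
  have : ((k.1 i).+1%:R <= M%:R :> R)%R by rewrite ler_nat.
  by rewrite -natr1; lra.
have := ler_normD (x ord0 i - sg k.2 * z) (sg k.2 * z); rewrite subrK.
rewrite [`|sg _ * _|]normrM norm_sg mul1r (ger0_norm z0); lra.
Qed.

Local Notation T k := (cell (phi 0%N) h (centre k)).

(** The contribution of one sign to the perturbation; rescaled, it is also the test function that
    detects this sign. *)
Definition wave (j : J) (x : V) : R := T (j, true) x - T (j, false) x.

Definition cube (A : R) (e : {ffun J -> bool}) : V -> R :=
  bumps phi h centre (fun=> 0%N) (fun k => A * (sg (e k.1) * sg k.2)).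

Lemma wave_opp j x : wave j (- x) = - wave j x.
Proof. by rewrite /wave !(cell_opp phi0E) !centre_neg opprB. Qed.

(** Groups the cells by mirror pairs. The general [tau] covers the perturbation and also the
    combinations of test functions in the Wasserstein bound. *)
Lemma bumps_waves (tau : J -> R) x :
  bumps phi h centre (fun=> 0%N) (fun k => tau k.1 * sg k.2) x =
  \sum_j tau j * wave j x.
Proof.
rewrite /bumps -(pair_bigA _ (fun j b => tau j * sg b *
  cell_term phi h centre (fun=> 0%N) (j, b) x)) /=.
apply: eq_bigr => j _; rewrite big_bool /= /wave /cell_term /cell; ring.
Qed.

Lemma cubeE A e x : cube A e x = \sum_j A * sg (e j) * wave j x.
Proof.
rewrite -(bumps_waves (fun j => A * sg (e j))); congr (bumps _ _ _ _ _ x).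
by apply/funext => k; rewrite mulrA.
Qed.

Lemma cube_opp A e x : cube A e (- x) = - cube A e x.
Proof.
by rewrite !cubeE -sumrN; apply: eq_bigr => j _; rewrite wave_opp mulrN.
Qed.

Lemma cell_inactive k x : ~~ active h centre k x -> T k x = 0.
Proof.
move=> /forallPn[i]; rewrite -leNgt => hi.
rewrite /cell (bigD1 i)//= (phi0_out phi0E) ?mul0r//.
by rewrite normrM normfV (gtr0_norm mesh_gt0) ler_pdivlMr ?mesh_gt0// mul1r.
Qed.

Lemma wave_sqr j x : wave j x ^+ 2 = T (j, true) x ^+ 2 + T (j, false) x ^+ 2.
Proof.
have H : T (j, true) x * T (j, false) x = 0.
  have [a1|n1] := boolP (active h centre (j, true) x); last first.
    by rewrite cell_inactive ?mul0r.
  have [a2|n2] := boolP (active h centre (j, false) x); last first.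
    by rewrite (cell_inactive n2) mulr0.
  by have := active_unique centre_sep a1 a2.
by rewrite /wave sqrrB H mul0rn subr0.
Qed.

Lemma wave_sqr_le j x : wave j x ^+ 2 <= T (j, true) x + T (j, false) x.
Proof.
rewrite wave_sqr; apply: lerD; rewrite expr2 ler_piMr ?(cell_ge0 phi0E) ?(cell_le1 phi0E)//.
Qed.

Lemma wave_le1 j x : `|wave j x| <= 1.
Proof.
have := cell_ge0 phi0E h (centre (j, true)) x; have := cell_le1 phi0E h (centre (j, true)) x.
have := cell_ge0 phi0E h (centre (j, false)) x; have := cell_le1 phi0E h (centre (j, false)) x.
by rewrite /wave ler_norml => *; apply/andP; split; lra.
Qed.

Lemma wave_disjoint x : exists w : option J, forall j, Some j != w -> wave j x = 0.
Proof.
have [w aw] := active_option centre_sep x.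
exists (omap fst w) => j jw; rewrite /wave !cell_inactive ?subrr//.
  by apply: contraNN jw => /aw <-.
by apply: contraNN jw => /aw <-.
Qed.

(** At each point at most one wave is nonzero. Either it is not that of [j], and the flip changes
    nothing, or the whole perturbation reduces to that wave and the flip reverses it. *)
Lemma cube_flip A e j x :
  (cube A (flip j e) x = cube A e x /\ wave j x = 0) \/
  (cube A e x = A * sg (e j) * wave j x /\ cube A (flip j e) x = - cube A e x).
Proof.
rewrite !cubeE; have [w ww] := wave_disjoint x.
have [wj|wj] := eqVneq (Some j) w.
  right; have sE (c : J -> R) : \sum_i c i * wave i x = c j * wave j x.
    rewrite (bigD1 j)//= big1 ?addr0// => i ij; rewrite ww ?mulr0// -wj.
    by apply: contra ij => /eqP[->].
  by rewrite !sE; split => //; rewrite ffunE eqxx sgN; ring.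
left; split; last exact: ww.
apply: eq_bigr => i _; rewrite ffunE; case: eqP => [->|//].
by rewrite (ww _ wj) !mulr0.
Qed.

Lemma cube_bounded A e x : 0 <= A -> `|cube A e x| <= A.
Proof.
move=> A0; rewrite cubeE; have [[j|] ww] := wave_disjoint x.
  rewrite (bigD1 j)//= big1 ?addr0.
    by rewrite !normrM norm_sg mulr1 (ger0_norm A0) ler_piMr ?wave_le1.
  by move=> i ij; rewrite ww ?mulr0//; apply: contra ij => /eqP[->].
by rewrite big1 ?normr0// => i _; rewrite ww ?mulr0.
Qed.

Lemma measurable_wave j : measurable_fun [set: V] (wave j).
Proof. by apply: measurable_funB; exact: measurable_cell phi0E _ _. Qed.

Lemma measurable_cube A e : measurable_fun [set: V] (cube A e).
Proof.
rewrite (_ : cube A e = fun x => \sum_j A * sg (e j) * wave j x); last first.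
  by apply/funext => x; rewrite cubeE.
by apply: measurable_sum => j; apply: measurable_funM => //; exact: measurable_wave.
Qed.

End hypercube.

(** * Expectations of bounded functions *)

Section bounded_expectation.
Context disp (T : measurableType disp) (R : realType).
Implicit Types (P : probability T R) (f g : T -> R).

Definition bounded_mfun f := measurable_fun [set: T] f /\ exists M, forall x, `|f x| <= M.

Lemma bounded_mfun_integrable P f : bounded_mfun f ->
  P.-integrable [set: T] (EFin \o f).
Proof.
have Poo : (P setT < +oo)%E by rewrite probability_setT ltry.
by move=> [mf [M fM]]; exact: bounded_integrable Poo mf fM.
Qed.

Lemma bounded_mfun_cst c : bounded_mfun (cst c).
Proof. by split=> //; exists `|c|. Qed.

Lemma bounded_mfunD f g : bounded_mfun f -> bounded_mfun g ->
  bounded_mfun (fun x => f x + g x).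
Proof.
move=> [mf [M fM]] [mg [M' gM]]; split; first exact: measurable_funD.
by exists (M + M') => x; apply: (le_trans (ler_normD _ _)); exact: lerD.
Qed.

Lemma bounded_mfunM f g : bounded_mfun f -> bounded_mfun g ->
  bounded_mfun (fun x => f x * g x).
Proof.
move=> [mf [M fM]] [mg [M' gM]]; split; first exact: measurable_funM.
by exists (M * M') => x; rewrite normrM ler_pM.
Qed.

Lemma bounded_mfun_expR f : bounded_mfun f -> bounded_mfun (fun x => expR (f x)).
Proof.
move=> [mf [M fM]]; split; first exact: measurableT_comp.
exists (expR M) => x; rewrite ger0_norm ?expR_ge0// ler_expR.
exact: le_trans (ler_norm _) _.
Qed.

Lemma RintegralD_bounded P f g : bounded_mfun f -> bounded_mfun g ->
  \int[P]_x (f x + g x) = \int[P]_x f x + \int[P]_x g x.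
Proof. by move=> bf bg; rewrite RintegralD//; exact: bounded_mfun_integrable. Qed.

Lemma RintegralZ_bounded P f c : bounded_mfun f ->
  \int[P]_x (c * f x) = c * \int[P]_x f x.
Proof. by move=> bf; rewrite RintegralZl//; exact: bounded_mfun_integrable. Qed.

Lemma le_Rintegral_bounded P f g : bounded_mfun f -> bounded_mfun g ->
  (forall x, f x <= g x) -> \int[P]_x f x <= \int[P]_x g x.
Proof.
by move=> bf bg fg; apply: le_Rintegral => //; exact: bounded_mfun_integrable.
Qed.

Lemma Rintegral_cst_prob P (c : R) : \int[P]_x (cst c x) = c.
Proof. by rewrite Rintegral_cst// [X in fine X](@probability_setT _ _ _ P) mulr1. Qed.

Lemma EFin_Rintegral_bounded P f : bounded_mfun f ->
  (\int[P]_x (f x)%:E)%E = (\int[P]_x f x)%:E.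
Proof.
move=> bf; rewrite fineK//; apply: integrable_fin_num => //.
exact: bounded_mfun_integrable.
Qed.

(** [integral_density] requires a nonnegative integrand; it is applied to f + M, and M cancels
    because [q] has integral 1. *)
Lemma Rintegral_density (mu P : probability T R) (q f : T -> R) :
  is_density mu P q -> bounded_mfun q -> bounded_mfun f ->
  \int[P]_x f x = \int[mu]_x (f x * q x).
Proof.
move=> [mq q0 Pq] bq bf; have [mf [M fM]] := bf.
have q1 : \int[mu]_x q x = 1.
  by rewrite /Rintegral -Pq// probability_setT.
have bfM : bounded_mfun (fun x => f x + M) by apply: bounded_mfunD => //; exact: bounded_mfun_cst.
have H : \int[P]_x (f x + M) = \int[mu]_x ((f x + M) * q x).
  rewrite /Rintegral (integral_density mq q0 Pq)//.
  - by apply/measurable_EFinP; case: bfM.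
  - move=> x; rewrite lee_fin; have := fM x; rewrite ler_norml => /andP[+ _]; lra.
move: H; rewrite RintegralD_bounded//; last exact: bounded_mfun_cst.
rewrite (Rintegral_cst_prob P M).
rewrite (_ : (fun x => (f x + M) * q x) = (fun x => f x * q x + M * q x)); last first.
  by apply/funext => x; rewrite mulrDl.
rewrite RintegralD_bounded; last 2 first.
- exact: bounded_mfunM.
- by apply: bounded_mfunM => //; exact: bounded_mfun_cst.
by rewrite RintegralZ_bounded// q1 mulr1 => /addIr.
Qed.

End bounded_expectation.

(** * Exponential inequalities *)

Section exp_ineq.
Context {R : realType}.

Lemma expR_le_inv (x : R) : 0 <= x -> x <= 2^-1 -> expR x <= 1 + x + 2 * x ^+ 2.
Proof.
move=> x0 x1; have h : expR x * (1 - x) <= 1.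
  rewrite -[leRHS](expRxMexpNx_1 x) ler_wpM2l ?expR_ge0//; exact: expR_ge1Dx.
have x1' : 0 < 1 - x by lra.
have : expR x <= (1 - x)^-1 by rewrite -div1r ler_pdivlMr.
move=> /le_trans; apply; rewrite -div1r ler_pdivrMr//.
have : 0 <= x ^+ 2 * (1 - 2 * x) by rewrite mulr_ge0 ?sqr_ge0//; lra.
have -> : (1 + x + 2 * x ^+ 2) * (1 - x) = 1 + x ^+ 2 * (1 - 2 * x) by ring.
lra.
Qed.

Lemma cosh_le (x : R) : `|x| <= 2^-1 -> (expR x + expR (- x)) / 2 <= 1 + 2 * x ^+ 2.
Proof.
wlog x0 : x / 0 <= x.
  move=> H; have [x0|x0] := leP 0 x; first exact: H.
  rewrite -normrN => xN; have := H (- x); rewrite opprK sqrrN (addrC (expR (- x))).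
  by apply => //; rewrite oppr_ge0 ltW.
rewrite ger0_norm// => x1; have h1 := expR_le_inv x0 x1.
have h2 : expR (- x) <= 1 - x + x ^+ 2.
  have x1' : 0 < 1 + x by lra.
  rewrite expRN -div1r ler_pdivrMr ?expR_gt0//.
  have h3 : 1 + x <= expR x := expR_ge1Dx x.
  have h4 : 0 <= 1 - x + x ^+ 2 by have := sqr_ge0 x; lra.
  apply: le_trans (ler_wpM2l h4 h3).
  have -> : (1 - x + x ^+ 2) * (1 + x) = 1 + x ^+ 3 by ring.
  by rewrite lerDl exprn_ge0.
have := sqr_ge0 x; lra.
Qed.

(** The pointwise gain when a wave is tested against the right and the wrong sign. Both sides are
    even in [w], which reduces to w >= 0. *)
Lemma mul_sinh_ge (w a : R) : 0 <= a ->
  a * w ^+ 2 <= w * (expR (a * w) - expR (- (a * w))).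
Proof.
move=> a0; wlog w0 : w / 0 <= w.
  move=> H; have [w0|w0] := leP 0 w; first exact: H.
  have := H (- w); rewrite sqrrN mulrN opprK mulNr -mulrN opprB; apply.
  by rewrite oppr_ge0 ltW.
have h1 : 1 + a * w <= expR (a * w) := expR_ge1Dx _.
have h2 : expR (- (a * w)) <= 1.
  by rewrite -expR0 ler_expR oppr_le0 mulr_ge0.
rewrite expr2 mulrA mulrC ler_wpM2l//; lra.
Qed.

End exp_ineq.

(** * Affinity and separation in the hypercube *)

Section hypercube_measure.
Context {R : realType} {d : nat}.
Local Notation V := 'rV[R]_d.
Hypothesis d_gt0 : (0 < d)%N.
Variables (B : nat) (phi : nat -> R -> R).
Hypothesis phi0E : phi 0%N = (fun t => pospow B.+2 (1 - t ^+ 2)).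
Variable M : nat.
Hypothesis M_gt0 : (0 < M)%N.
Variable A : R.
Hypotheses (A0 : 0 <= A) (A1 : A <= 2^-1).
Variable G : probability V R.
Hypothesis dG : is_density lebesgue_rV G gauss.

Local Notation h := (@mesh R M).
Local Notation J := {ffun 'I_d -> 'I_M}.
Local Notation cube := (@cube R d phi M A).
Local Notation wave := (@wave R d phi M).

Lemma integral_G (f : V -> R) : measurable_fun [set: V] f -> (forall x, 0 <= f x) ->
  (\int[G]_x (f x)%:E = \int[lebesgue_rV]_x (f x * gauss x)%:E)%E.
Proof.
move=> mf f0; have [mg g0 Gg] := dG.
rewrite (integral_density mg g0 Gg)//; first exact/measurable_EFinP.
Qed.

Lemma Rintegral_G_opp (f : V -> R) : measurable_fun [set: V] f -> (forall x, 0 <= f x) ->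
  \int[G]_x f (- x) = \int[G]_x f x.
Proof.
move=> mf f0.
have mopp : measurable_fun [set: V] (fun x : V => - x).
  apply: measurable_fun_rV => i; under eq_fun do rewrite mxE.
  by apply: measurableT_comp => //; exact: measurable_coord.
have [mg g0 _] := dG.
rewrite /Rintegral !integral_G//; last exact: (measurableT_comp mf mopp).
rewrite -(integral_lebesgue_rV_opp (g := fun x => (f x * gauss x)%:E)).
- apply: f_equal; apply: eq_integral => x _.
  by rewrite (gauss_opp x).
- by apply/measurable_EFinP; exact: measurable_funM.
- by move=> x; rewrite lee_fin mulr_ge0.
Qed.

Lemma bounded_cube e : bounded_mfun (cube e).
Proof.
split; first exact: measurable_cube phi0E _ _ _.
by exists A => x; exact: (cube_bounded d_gt0 phi0E M_gt0).
Qed.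

Lemma bounded_cubeN e : bounded_mfun (fun x => - cube e x).
Proof.
have [mc [c cc]] := bounded_cube e; split; first exact: measurableT_comp.
by exists c => x; rewrite normrN.
Qed.

Lemma bounded_wave j : bounded_mfun (wave j).
Proof.
split; first exact: measurable_wave phi0E _ _.
by exists 1 => x; exact: (wave_le1 phi0E).
Qed.

Lemma bounded_wave_sqr j : bounded_mfun (fun x => wave j x ^+ 2).
Proof.
by under eq_fun do rewrite expr2; apply: bounded_mfunM; exact: bounded_wave.
Qed.

Definition normalizer e : R := \int[G]_x expR (cube e x).
Local Notation Z := normalizer.

Lemma normalizer_flip e j : Z (flip j e) = Z e.
Proof.
have ZN e' : Z e' = \int[G]_x expR (- cube e' x).
  rewrite /Z -[LHS](Rintegral_G_opp (f := fun x => expR (cube e' x))).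
  - by congr fine; apply: eq_integral => x _; rewrite (cube_opp phi0E).
  - by case: (bounded_mfun_expR (bounded_cube e')).
  - by move=> x; exact: expR_ge0.
have Z2 e' : Z e' + Z e' = \int[G]_x (expR (cube e' x) + expR (- cube e' x)).
  rewrite {2}ZN RintegralD_bounded//; apply: bounded_mfun_expR.
    exact: bounded_cube.
  exact: bounded_cubeN.
(* Doubled, a normalizer is the integral of 2 cosh of the perturbation, which a change of sign
   leaves alone at every point. *)
suff : Z (flip j e) + Z (flip j e) = Z e + Z e.
  by move: (Z (flip j e)) (Z e) => a b; lra.
apply: (etrans (Z2 (flip j e))); apply: (etrans _ (esym (Z2 e))).
apply: eq_Rintegral => x _.
have [[-> _]//|[_ ->]] := cube_flip d_gt0 phi0E M_gt0 A e j x.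
by rewrite opprK addrC.
Qed.

Lemma normalizer_ge e : expR (- 2^-1) <= Z e.
Proof.
rewrite -[leLHS](Rintegral_cst_prob G); apply: le_Rintegral_bounded.
- exact: bounded_mfun_cst.
- exact: bounded_mfun_expR (bounded_cube e).
- move=> x; rewrite ler_expR; have := cube_bounded d_gt0 phi0E M_gt0 e x A0.
  rewrite ler_norml => /andP[+ _]; have := A1; lra.
Qed.

Lemma normalizer_le2 e : Z e <= 2.
Proof.
apply: (@le_trans _ _ (expR 2^-1)); last first.
  rewrite -[2^-1]opprK expRN -[leRHS]invrK lef_pV2 ?posrE ?expR_gt0 ?invr_gt0//.
  by apply: le_trans (expR_ge1Dx _); lra.
rewrite -[leRHS](Rintegral_cst_prob G); apply: le_Rintegral_bounded.
- exact: bounded_mfun_expR (bounded_cube e).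
- exact: bounded_mfun_cst.
- move=> x; rewrite ler_expR; have := cube_bounded d_gt0 phi0E M_gt0 e x A0.
  rewrite ler_norml => /andP[_ +]; have := A1; lra.
Qed.

Lemma normalizer_gt0 e : 0 < Z e.
Proof. exact: lt_le_trans (expR_gt0 _) (normalizer_ge e). Qed.

Lemma normalizer_ge_half e : 2^-1 <= Z e.
Proof.
apply: le_trans (normalizer_ge e); apply: le_trans (expR_ge1Dx _); lra.
Qed.

(** Least Gaussian density on the cells times the constant of [integral_cell_sqr_ge]. *)
Definition energy_cst : R := gauss_min (R := R) (d := d) * ((3 / 4) ^+ B.+2 ^+ 2) ^+ d.

Lemma wave_energy_ge j : energy_cst * h ^+ d <= \int[G]_x (wave j x ^+ 2).
Proof.
have h0 : 0 < h := mesh_gt0 M_gt0.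
rewrite -lee_fin -EFin_Rintegral_bounded; last exact: bounded_wave_sqr.
have [mw _] := bounded_wave_sqr j.
rewrite integral_G//; last by move=> x; exact: sqr_ge0.
pose T := cell (phi 0%N) h (centre (j, true)).
have mT : measurable_fun [set: V] (fun x => T x ^+ 2).
  by apply: measurable_funX; exact: measurable_cell phi0E _ _.
apply: (@le_trans _ _ (\int[lebesgue_rV]_x ((gauss_min (R := R) (d := d))%:E * (T x ^+ 2)%:E))%E).
  rewrite ge0_integralZl//; last 3 first.
  - exact/measurable_EFinP.
  - by move=> x _; rewrite lee_fin sqr_ge0.
  - by rewrite lee_fin ltW// gauss_min_gt0.
  rewrite /energy_cst -mulrA EFinM; apply: lee_wpmul2l.
    by rewrite lee_fin ltW// gauss_min_gt0.
  by rewrite -exprMn; exact: integral_cell_sqr_ge phi0E _ h0 _.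
have [mg g0 _] := dG.
apply: ge0_le_integral => //.
- by move=> x _; rewrite mule_ge0 ?lee_fin ?sqr_ge0// ltW// gauss_min_gt0.
- by apply: emeasurable_funM => //; exact/measurable_EFinP.
- by apply/measurable_EFinP; exact: measurable_funM.
- move=> x _; rewrite -EFinM lee_fin.
  have [ax|nx] := boolP (active h (@centre R d M) (j, true) x); last first.
    by rewrite /T (cell_inactive phi0E M_gt0 nx) expr0n mulr0 mulr_ge0 ?sqr_ge0.
  rewrite mulrC ler_pM ?sqr_ge0 ?(ltW gauss_min_gt0)//.
    by rewrite (wave_sqr d_gt0 phi0E M_gt0) lerDl sqr_ge0.
  by apply: gauss_ge; exact: (centre_le1 M_gt0 ax).
Qed.

Lemma wave_energy_le j : \int[G]_x (wave j x ^+ 2) <= 2 * (2 * h) ^+ d.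
Proof.
have h0 : 0 < h := mesh_gt0 M_gt0.
rewrite -lee_fin -EFin_Rintegral_bounded; last exact: bounded_wave_sqr.
have [mw _] := bounded_wave_sqr j.
rewrite integral_G//; last by move=> x; exact: sqr_ge0.
have [mg g0 _] := dG.
pose T b := cell (phi 0%N) h (centre (j, b)).
have mT b : measurable_fun [set: V] (T b) by exact: measurable_cell phi0E _ _.
apply: (@le_trans _ _ (\int[lebesgue_rV]_x ((T true x)%:E + (T false x)%:E))%E).
  apply: ge0_le_integral => //.
  - by move=> x _; rewrite lee_fin mulr_ge0 ?sqr_ge0.
  - by apply/measurable_EFinP; exact: measurable_funM.
  - by apply: emeasurable_funD; apply/measurable_EFinP.
  - move=> x _; rewrite -EFinD lee_fin.
    apply: le_trans (wave_sqr_le d_gt0 phi0E M_gt0 j x).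
    by rewrite ler_piMr ?sqr_ge0// gauss_le1.
rewrite ge0_integralD//; last 4 first.
- by move=> x _; rewrite lee_fin (cell_ge0 phi0E).
- exact/measurable_EFinP.
- by move=> x _; rewrite lee_fin (cell_ge0 phi0E).
- exact/measurable_EFinP.
rewrite mulr_natl mulr2n EFinD; apply: leeD; exact: integral_cell_le phi0E _ h0 _.
Qed.

Definition likelihood e (x : V) : R := expR (cube e x) / Z e.

Lemma bounded_likelihood e : bounded_mfun (likelihood e).
Proof.
apply: bounded_mfunM; first exact: bounded_mfun_expR (bounded_cube e).
exact: bounded_mfun_cst.
Qed.

Lemma likelihood_ge0 e x : 0 <= likelihood e x.
Proof. by rewrite divr_ge0 ?expR_ge0// ltW// normalizer_gt0. Qed.

Lemma Rintegral_likelihood e : \int[G]_x likelihood e x = 1.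
Proof.
rewrite /likelihood; under eq_Rintegral do rewrite mulrC.
rewrite RintegralZ_bounded; last exact: bounded_mfun_expR (bounded_cube e).
by rewrite mulVf// gt_eqF// normalizer_gt0.
Qed.

(** The arithmetic mean of the two likelihoods exceeds their geometric mean only on the two cells of
    [j], and there by (cosh(u) - 1)/Z <= 4 u^2 with u the perturbation. Integrating with
    [wave_energy_le] gives the constant 8. *)
Lemma hypercube_affinity e j : exists (r : V -> R) (rho : R),
  [/\ measurable_fun [set: V] r, forall x, 0 <= r x,
    forall x, r x ^+ 2 = likelihood e x * likelihood (flip j e) x,
    (\int[G]_x (r x)%:E = rho%:E)%E & 1 - 8 * A ^+ 2 * (2 * h) ^+ d <= rho].
Proof.
(* Equal normalizers make the geometric mean explicit. *)
pose r x := expR ((cube e x + cube (flip j e) x) / 2) / Z e.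
have br : bounded_mfun r.
  apply: bounded_mfunM; last exact: bounded_mfun_cst.
  apply: bounded_mfun_expR; apply: bounded_mfunM; last exact: bounded_mfun_cst.
  by apply: bounded_mfunD; exact: bounded_cube.
exists r, (\int[G]_x r x); split.
- by case: br.
- by move=> x; rewrite divr_ge0 ?expR_ge0// ltW// normalizer_gt0.
- move=> x; rewrite /r /likelihood normalizer_flip.
  rewrite mulrACA -expRD exprMn expr2 -expRD -mulrDl; congr (expR _ * _).
  by field.
- exact: EFin_Rintegral_bounded.
have bl := bounded_likelihood.
have H : \int[G]_x (2^-1 * (likelihood e x + likelihood (flip j e) x)) <=
    \int[G]_x (r x + 4 * A ^+ 2 * wave j x ^+ 2).
  apply: le_Rintegral_bounded.
  - apply: bounded_mfunM; first exact: bounded_mfun_cst.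
    exact: (bounded_mfunD (bl e) (bl (flip j e))).
  - apply: bounded_mfunD => //; apply: bounded_mfunM; last exact: bounded_wave_sqr.
    exact: bounded_mfun_cst.
  move=> x; rewrite /likelihood normalizer_flip /r.
  have Zi : 0 < (Z e)^-1 by rewrite invr_gt0 normalizer_gt0.
  have Zi2 : (Z e)^-1 <= 2.
    by rewrite invf_ple ?posrE ?normalizer_gt0// normalizer_ge_half.
  have [[-> w0]|[ae ->]] := cube_flip d_gt0 phi0E M_gt0 A e j x.
    rewrite w0 expr0n mulr0 addr0 le_eqVlt; apply/orP; left; apply/eqP.
    rewrite (_ : (cube e x + cube e x) / 2 = cube e x); last by field.
    by field; rewrite gt_eqF// normalizer_gt0.
  rewrite subrr mul0r expR0.
  have ca : `|cube e x| <= 2^-1 by exact: le_trans (cube_bounded d_gt0 phi0E M_gt0 e x A0) A1.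
  have h1 := cosh_le ca.
  have sq : cube e x ^+ 2 = A ^+ 2 * wave j x ^+ 2.
    rewrite ae !exprMn; congr (_ * _); rewrite -[RHS]mulr1; congr (_ * _).
    by rewrite -real_normK ?num_real// norm_sg expr1n.
  rewrite sq in h1; have Aw : 0 <= A ^+ 2 * wave j x ^+ 2 by rewrite mulr_ge0 ?sqr_ge0.
  have h2 := ler_wpM2r (ltW Zi) h1; have h3 := ler_wpM2l Aw Zi2.
  lra.
have bsum := bounded_mfunD (bl e) (bl (flip j e)).
have half : \int[G]_x (2^-1 * (likelihood e x + likelihood (flip j e) x)) = 1.
  rewrite (@RintegralZ_bounded _ _ _ G _ 2^-1 bsum).
  rewrite (@RintegralD_bounded _ _ _ G _ _ (bl e) (bl (flip j e))).
  have L1 := Rintegral_likelihood e; have L2 := Rintegral_likelihood (flip j e).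
  by apply: (etrans (congr2 (fun a b => 2^-1 * (a + b)) L1 L2)); field.
rewrite half in H.
have bwA : bounded_mfun (fun x => 4 * A ^+ 2 * wave j x ^+ 2).
  apply: bounded_mfunM; [exact: bounded_mfun_cst|exact: bounded_wave_sqr].
rewrite (@RintegralD_bounded _ _ _ G _ _ br bwA) in H.
rewrite (@RintegralZ_bounded _ _ _ G _ (4 * A ^+ 2) (bounded_wave_sqr j)) in H.
have := ler_wpM2l (sqr_ge0 A) (wave_energy_le j).
lra.
Qed.

(** Pointwise, the wave times the difference of likelihoods is at least A/2 times the squared wave:
    [mul_sinh_ge] gives the factor A and [normalizer_le2] the factor 1/2. *)
Lemma hypercube_separation e j :
  A / 2 * (energy_cst * h ^+ d) <=
    `|\int[G]_x (wave j x * likelihood e x) -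
      \int[G]_x (wave j x * likelihood (flip j e) x)|.
Proof.
wlog ej : e / e j.
  move=> H; have [ej|ej] := boolP (e j); first exact: H.
  by rewrite distrC -{2}(flipK j e); apply: H; rewrite ffunE eqxx.
apply: le_trans (ler_norm _); rewrite lerBrDl.
have bl := bounded_likelihood; have bw := bounded_wave j.
have H : \int[G]_x (wave j x * likelihood (flip j e) x + A / 2 * wave j x ^+ 2) <=
    \int[G]_x (wave j x * likelihood e x).
  apply: le_Rintegral_bounded.
  - apply: bounded_mfunD; first exact: bounded_mfunM.
    by apply: bounded_mfunM; [exact: bounded_mfun_cst|exact: bounded_wave_sqr].
  - exact: bounded_mfunM.
  move=> x; rewrite /likelihood normalizer_flip.
  have Zi : 2^-1 <= (Z e)^-1.
    by rewrite lef_pV2 ?posrE ?normalizer_gt0// normalizer_le2.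
  have [[-> ->]|[ae ->]] := cube_flip d_gt0 phi0E M_gt0 A e j x.
    by rewrite !mul0r expr0n mulr0 addr0.
  rewrite ej /= mulr1 in ae.
  have h1 := mul_sinh_ge (wave j x) A0; rewrite -ae in h1.
  have h0 : 0 <= A * wave j x ^+ 2 by rewrite mulr_ge0 ?sqr_ge0.
  have h2 := ler_wpM2l h0 Zi.
  have Zi0 : 0 <= (Z e)^-1 by apply: le_trans Zi.
  have h3 := ler_wpM2r Zi0 h1.
  lra.
have bwA : bounded_mfun (fun x => A / 2 * wave j x ^+ 2).
  apply: bounded_mfunM; [exact: bounded_mfun_cst|exact: bounded_wave_sqr].
have bwl := bounded_mfunM bw (bl (flip j e)).
rewrite (@RintegralD_bounded _ _ _ G _ _ bwl bwA) in H.
rewrite (@RintegralZ_bounded _ _ _ G _ (A / 2) (bounded_wave_sqr j)) in H.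
have A20 : 0 <= A / 2 by rewrite divr_ge0.
by apply: le_trans H; rewrite lerD2l; exact: (ler_wpM2l A20 (wave_energy_ge j)).
Qed.

End hypercube_measure.

(** * The lower bound *)

Lemma bernoulli_half (R : realFieldType) (n : nat) (rho : R) : (0 < n)%N ->
  1 - (2 * n%:R)^-1 <= rho -> 2^-1 <= rho ^+ n.
Proof.
move=> n0 rhon; have n0R : 0 < n%:R :> R by rewrite ltr0n.
have x0 : 0 <= (2 * n%:R)^-1 :> R by rewrite invr_ge0 mulr_ge0.
have n1 : 1 <= n%:R :> R by rewrite ler1n.
have x1 : (2 * n%:R)^-1 <= 1 :> R by rewrite invf_le1 ?mulr_gt0//; lra.
set x := (2 * n%:R)^-1 in x0 x1 rhon *.
have bern k : 1 - k%:R * x <= (1 - x) ^+ k.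
  elim: k => [|k IH]; first by rewrite mul0r subr0.
  have h1 : 0 <= 1 - x by lra.
  rewrite exprS; apply: le_trans (ler_wpM2l h1 IH).
  have : 0 <= k%:R * x * x by rewrite !mulr_ge0.
  rewrite -natr1; lra.
apply: (@le_trans _ _ ((1 - x) ^+ n)); last by rewrite lerXn2r ?nnegrE//; lra.
apply: le_trans (bern n).
have -> : n%:R * x = 2^-1 by rewrite /x; field; rewrite gt_eqF.
lra.
Qed.

(** Membership in the model is stated with Lebesgue densities, the testing argument with Gaussian
    ones; this passes from the first to the second. *)
Lemma integral_mulr_density d (T : measurableType d) (R : realType)
    (mu : {sigma_finite_measure set T -> \bar R}) (P G : probability T R)
    (g l : T -> R) :
  is_density mu G g -> measurable_fun [set: T] l -> (forall x, 0 <= l x) ->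
  is_density mu P (fun x => g x * l x) -> is_density G P l.
Proof.
move=> [mg g0 Gg] ml l0 [_ _ Pgl]; split => // A mA; rewrite Pgl//.
have mlE : measurable_fun [set: T] (EFin \o l) by exact/measurable_EFinP.
rewrite [RHS]integral_mkcond (integral_density mg g0 Gg).
- rewrite [LHS]integral_mkcond; apply: eq_integral => x _.
  rewrite /patch; case: ifPn => _; last by rewrite mul0e.
  by rewrite mulrC EFinM.
- by apply/(measurable_restrictT _ _).1 => //; exact: measurable_funTS.
- by move=> x; apply: erestrict_ge0 => y _; rewrite lee_fin.
Qed.

(** Shifting [f] by its bound gives a nonnegative integrand, and the shift is removed because the
    kernel has mass 1. *)
Lemma measurable_Rintegral_kernel d d' (X : measurableType d) (Y : measurableType d')
    (R : realType) (k : R.-pker X ~> Y) (f : Y -> R) : bounded_mfun f ->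
  measurable_fun [set: X] (fun x => \int[k x]_y f y).
Proof.
move=> bf; have [mf [M fM]] := bf.
have k1 x : k x [set: Y] = 1%E by exact: prob_kernel.
have E x : \int[k x]_y f y = fine (\int[k x]_y (f y + M)%:E)%E - M.
  have koo : (k x [set: Y] < +oo)%E by rewrite k1 ltry.
  have i1 : (k x).-integrable [set: Y] (EFin \o f) by exact: bounded_integrable koo mf fM.
  have i2 : (k x).-integrable [set: Y] (EFin \o cst M).
    by apply: (@bounded_integrable _ _ _ _ _ `|M|).
  rewrite -[fine _]/(\int[k x]_y (f y + M)) RintegralD//.
  by rewrite Rintegral_cst// k1 mulr1 addrK.
rewrite (_ : (fun x => _) = (fun x => fine (\int[k x]_y (f y + M)%:E)%E - M)); last first.
  by apply/funext => x; exact: E.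
apply: measurable_funB => //; apply: measurableT_comp => //.
apply: measurable_fun_integral_kernel.
- by move=> U mU; exact: measurable_kernel.
- by move=> y; rewrite lee_fin; have := fM y; rewrite ler_norml => /andP[+ _]; lra.
- by apply/measurable_EFinP; apply: measurable_funD.
Qed.

Section lower_bound.
Context {R : realType} {d : nat}.
Local Notation V := 'rV[R]_d.
Hypothesis d_ge3 : (3 <= d)%N.
Variables (beta K : R).
Hypotheses (beta_gt0 : 0 < beta) (K_ge1 : 1 <= K).
Variables (phi : nat -> R -> R) (C : R).
Local Notation B := (Num.truncn beta).
Hypothesis C1 : 1 <= C.
Hypothesis phi0E : phi 0%N = (fun t => pospow B.+2 (1 - t ^+ 2)).
Hypothesis dphi : forall k (t : R), (k <= B)%N ->
  is_derive t (1 : R) (phi k) (phi k.+1 t).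
Hypothesis phiC : forall k t, (k <= B.+1)%N -> `|phi k t| <= C.
Hypothesis phi_supp : forall k t, (k <= B.+1)%N -> 1 <= `|t| -> phi k t = 0.

Local Notation Hc := (@holder_cst R d C).

(** Small enough for three demands, listed in [amplitude_le]: perturbation at most 1/2, Hölder norm
    at most 1, and affinity loss at most 1/(2n). *)
Definition amplitude : R :=
  (2 ^+ (d + 4) * (#|{: @mindex d B}|%:R + 1) * Hc)^-1.

Lemma Hc_ge1 : 1 <= Hc.
Proof.
have C0 : 0 <= C by exact: le_trans ler01 C1.
have [h _] := @holder_cst_ge R d C C1; apply: le_trans h.
have : 1 <= C ^+ d by exact: exprn_ege1.
lra.
Qed.

Lemma amplitude_gt0 : 0 < amplitude.
Proof.
have Hc0 : 0 < Hc := lt_le_trans ltr01 Hc_ge1.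
by rewrite invr_gt0 !mulr_gt0 ?exprn_gt0 ?ltr_wpDl// (lt_le_trans ltr01 C1).
Qed.

Lemma amplitude_le : [/\ amplitude <= 2^-1,
  2 * #|{: @mindex d B}|%:R * (amplitude * Hc) <= 1 &
  8 * amplitude ^+ 2 * 2 ^+ d <= 2^-1].
Proof.
have Hc1 := Hc_ge1.
have N0 : 0 <= #|{: @mindex d B}|%:R :> R by exact: ler0n.
have two : 2 <= 2 ^+ (d + 4) :> R.
  by rewrite -[leLHS]expr1 ler_weXn2l// ?ler1n// addn4.
set N := #|{: _}|%:R in N0 *.
pose D := (2 ^+ (d + 4) * (N + 1) * Hc).
have Hc0 : 0 < Hc := lt_le_trans ltr01 Hc1.
have D0 : 0 < D by rewrite !mulr_gt0 ?exprn_gt0 ?ltr_wpDl// (lt_le_trans ltr01 C1).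
have aE : amplitude = D^-1 by [].
have aD : amplitude * D = 1 by rewrite aE mulVf// gt_eqF.
have a0 : 0 < amplitude := amplitude_gt0.
have N1H : 1 <= (N + 1) * Hc by apply: mulr_ege1 => //; lra.
have a1 : amplitude * 2 ^+ (d + 4) <= 1.
  apply: (@le_trans _ _ (amplitude * D)); last by rewrite aD.
  apply: ler_wpM2l; first exact: ltW.
  have -> : D = 2 ^+ (d + 4) * ((N + 1) * Hc) by rewrite /D mulrA.
  by rewrite ler_peMr// exprn_ge0.
split.
- have : amplitude * 2 <= amplitude * 2 ^+ (d + 4) by rewrite ler_wpM2l// ltW.
  lra.
- apply: (@le_trans _ _ (amplitude * D)); last by rewrite aD.
  rewrite (_ : 2 * N * _ = amplitude * (2 * N * Hc)); last by ring.
  rewrite ler_wpM2l ?(ltW a0)// /D; apply: ler_wpM2r; first by lra.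
  by apply: ler_pM => //; lra.
- have E : 8 * amplitude ^+ 2 * 2 ^+ d = amplitude * (amplitude * 2 ^+ (d + 4)) / 2.
    by rewrite exprD; field.
  rewrite E; have : amplitude * (amplitude * 2 ^+ (d + 4)) <= 1 * 1.
    apply: ler_pM => //; first exact: ltW.
      by rewrite mulr_ge0 ?exprn_ge0// ltW.
    apply: le_trans a1; rewrite ler_peMr ?(ltW a0)//; lra.
  lra.
Qed.

(** What remains of #|J| Delta/16 once h^(beta + 1) is taken out: 16 comes from [assouad], 2 from
    [hypercube_separation], [Hc] from the scaling of the test functions and 2^d from #|J| =
    (2h)^(-d). *)
Definition rate_cst : R := amplitude * @energy_cst R d B / (32 * Hc * 2 ^+ d).

Lemma hypercube_risk (n M : nat) (phat : R.-pker (n.-tuple V) ~> V) :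
  (0 < n)%N -> (0 < M)%N ->
  n%:R * ((@mesh R M `^ beta) ^+ 2 * @mesh R M ^+ d) <= 1 ->
  exists2 P, model beta K P &
    ((rate_cst * (@mesh R M `^ beta * @mesh R M))%:E <= risk phat P)%E.
Proof.
move=> n0 M0; set h := @mesh R M => nh.
have d0 : (0 < d)%N by exact: leq_trans d_ge3.
have h0 : 0 < h := mesh_gt0 M0; have h1 : h <= 1 := mesh_le1 M0.
have Hc1 := Hc_ge1; have [ka1 ka2 ka3] := amplitude_le; have ka0 := amplitude_gt0.
have hb0 : 0 <= h `^ beta by exact: powR_ge0.
have hb1 : h `^ beta <= 1.
  by rewrite -[leRHS](powRr0 h) ger_powR ?h0// ltW.
pose A := amplitude * h `^ beta.
have A0 : 0 <= A by rewrite mulr_ge0// ltW.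
have A1 : A <= 2^-1.
  by apply: le_trans ka1; rewrite ler_piMr// ltW.
have [G dG] := exists_probability_density (@measurable_gauss R d) (@gauss_ge0 R d)
  (@integral_gauss R d).
pose J := {ffun 'I_d -> 'I_M}.
pose Z (e : {ffun J -> bool}) := normalizer phi A G e.
pose l (e : {ffun J -> bool}) := likelihood phi A G e.
pose u := cube phi A : {ffun J -> bool} -> V -> R.
have Z0 e : 0 < Z e := normalizer_gt0 d0 phi0E M0 A0 A1 G e.
have l0 e x : 0 <= l e x := likelihood_ge0 d0 phi0E M0 A0 A1 G e x.
have bl e : bounded_mfun (l e) := bounded_likelihood d0 phi0E M0 A0 G e.
have ml e : measurable_fun [set: V] (l e) by case: (bl e).
pose p e x := gauss x * l e x.
have mp e : measurable_fun [set: V] (p e).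
  by apply: measurable_funM => //; exact: measurable_gauss.
have p0 e x : 0 <= p e x by rewrite mulr_ge0// gauss_ge0.
have p1 e : (\int[lebesgue_rV]_x (p e x)%:E = 1)%E.
  under eq_integral => x _ do rewrite /p mulrC.
  rewrite -(integral_G dG)// EFin_Rintegral_bounded//.
  by rewrite (Rintegral_likelihood d0 phi0E M0 A0 A1).
have [P dP] := choice (fun e => exists_probability_density (mp e) (p0 e) (p1 e)).
have dPG e : is_density G (P e) (l e) by exact: integral_mulr_density dG _ _ (dP e).
have mP e : model beta K (P e).
  (* The normalizer goes into the potential, so the Hölder bound concerns the bumps alone. *)
  exists (p e), (EFin \o quad (@gauss_cst R d + ln (Z e))), (u e).
  split; first exact: dP.
  have cA k : `|A * (sg (e k.1) * sg k.2)| <= amplitude * h `^ beta.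
    by rewrite (normrM A) (normrM (sg _)) !norm_sg !mulr1 (ger0_norm A0).
  have [uC uH] := bumps_holder_ball C1 dphi phiC phi_supp h0 (centre_sep d0 M0) h1
    (erefl B) (ltW beta_gt0) (ltW ka0) cA.
  apply: admissible_quad => //.
  - have lnZ : - 2^-1 <= ln (Z e).
      by rewrite -[leLHS]expRK ler_ln ?posrE ?expR_gt0//;
        exact: (normalizer_ge d0 phi0E M0 A0 A1).
    have := @gauss_cst_ge R d d_ge3; lra.
  - move=> x; rewrite /p /l /likelihood gaussE -/(Z e).
    rewrite -[in (Z e)^-1](lnK (Z0 e)) -expRN -!expRD; congr expR.
    by rewrite /quad /u; ring.
  - by apply: (le_trans uH); rewrite lee_fin (le_trans ka2).
(* Combinations of waves with coefficients in [-1, 1] have Lipschitz constant at most Hc/h. *)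
pose s := h / Hc.
have Hc0 : 0 < Hc := lt_le_trans ltr01 Hc1.
have s0 : 0 < s by rewrite divr_gt0.
pose g (j : J) (x : V) := s * wave phi j x.
have bw (j : J) : bounded_mfun (wave phi j) := bounded_wave phi0E j.
have bg j : bounded_mfun (g j).
  by apply: bounded_mfunM; [exact: bounded_mfun_cst|exact: bw].
have gs j x : `|g j x| <= s.
  by rewrite normrM (gtr0_norm s0) ler_piMr ?(ltW s0)// (wave_le1 phi0E).
have gL (tau : J -> R) : (forall j, `|tau j| <= 1) -> forall x y,
    `|\sum_j tau j * g j x - \sum_j tau j * g j y| <= enorm (x - y).
  move=> tau1 x y.
  have gE z : \sum_j tau j * g j z =
      s * bumps phi h (@centre R d M) (fun=> 0%N) (fun k => tau k.1 * sg k.2) z.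
    by rewrite bumps_waves mulr_sumr; apply: eq_bigr => j _; rewrite mulrCA.
  have c1 (k : J * bool) : `|tau k.1 * sg k.2| <= 1 by rewrite normrM norm_sg mulr1.
  have lip := bumps_lipschitz C1 dphi phiC phi_supp h0 (centre_sep d0 M0)
    (kap := fun=> 0%N) x y ler01 c1 (fun=> leq0n _).
  rewrite !gE -mulrBr normrM (gtr0_norm s0).
  apply: (le_trans (ler_wpM2l (ltW s0) lip)); rewrite mul1r.
  have [_ hc2] := @holder_cst_ge R d C C1.
  rewrite (_ : s * _ = enorm (x - y) * (2 * (d%:R * C ^+ d * C) / Hc)); last first.
    by rewrite /s; move: (Hc) Hc0 => H H0; field; rewrite !gt_eqF.
  by rewrite ler_piMr ?sqrtr_ge0// ler_pdivrMr// mul1r.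
pose theta e j := \int[P e]_x g j x.
pose est (j : J) X := \int[phat X]_x g j x.
pose loss e X := W1 (P e) (phat X).
pose Delta := s * (A / 2 * (@energy_cst R d B * h ^+ d)).
have E0 : 0 <= @energy_cst R d B.
  apply: mulr_ge0; first exact: (ltW (@gauss_min_gt0 R d)).
  by rewrite exprn_ge0// sqr_ge0.
have Delta0 : 0 <= Delta.
  apply: mulr_ge0; first exact: ltW.
  apply: mulr_ge0; first by rewrite divr_ge0.
  by apply: mulr_ge0 => //; rewrite exprn_ge0// ltW.
have thetaE e j : theta e j = s * \int[G]_x (wave phi j x * l e x).
  rewrite /theta (Rintegral_density (dPG e) (bl e) (bg j)).
  rewrite -RintegralZ_bounded; last by apply: bounded_mfunM.
  by apply: eq_Rintegral => x _; rewrite /g mulrA.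
have [||||||e] := @assouad _ _ _ G J P l n theta est loss Delta.
- exact: Delta0.
- exact: dPG.
- move=> e j; have [r [rho [mr r0 r2 rint rhoge]]] :=
    hypercube_affinity d0 phi0E M0 A0 A1 dG e j.
  exists r, rho; split => //; apply: bernoulli_half => //.
  (* The loss 8 A^2 (2h)^d is at most 1/(2n): [ka3] bounds the constant and [nh] the power of
     [h]. *)
  apply: le_trans rhoge; rewrite lerD2l lerN2.
  have nR : 0 < n%:R :> R by rewrite ltr0n.
  rewrite -[leRHS]mul1r ler_pdivlMr ?mulr_gt0//.
  rewrite (_ : 8 * A ^+ 2 * (2 * h) ^+ d * (2 * n%:R) = 2 * (8 * amplitude ^+ 2 * 2 ^+ d) *
    (n%:R * ((h `^ beta) ^+ 2 * h ^+ d))); last first.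
    by rewrite /A !exprMn; move: (2 ^+ d : R) (h ^+ d) => a b; ring.
  rewrite -[leRHS]mulr1; apply: ler_pM => //; last by lra.
    by rewrite !mulr_ge0 ?exprn_ge0 ?(ltW ka0).
  by rewrite mulr_ge0// mulr_ge0// exprn_ge0// ltW.
- move=> e j; rewrite !thetaE -mulrBr normrM (gtr0_norm s0) ler_wpM2l ?(ltW s0)//.
  exact: hypercube_separation.
- by move=> j; exact: measurable_Rintegral_kernel.
- move=> e X; have Poo : (P e setT < +oo)%E by rewrite probability_setT ltry.
  have Qoo : (phat X setT < +oo)%E by rewrite prob_kernel ltry.
  by apply: (W1_ge_sum Poo Qoo _ gs gL) => j; case: (bg j).
move=> He; exists (P e); first exact: mP.
apply: le_trans He; rewrite lee_fin.
have -> : #|J|%:R = (2 * h) ^- d :> R.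
  rewrite card_ffun !card_ord natrX /h /mesh -exprVn; congr (_ ^+ _).
  by rewrite invfM invrK mulrA mulVf// mul1r.
rewrite /rate_cst /Delta /A /s le_eqVlt; apply/orP; left; apply/eqP.
rewrite exprMn; move: (Hc) Hc0 => H H0.
by field; rewrite !expf_neq0 ?gt_eqF.
Qed.

End lower_bound.

(** With N = n^(1/(2 beta + d)) >= 1, rounding N up to an integer M gives M <= 2N, so that 1/(4N) <=
    h <= 1/N. The upper bound keeps the sample uninformative and the lower one produces the 4. *)
Lemma exists_mesh (R : realType) (d : nat) (beta : R) (n : nat) : 0 < beta ->
  (0 < n)%N -> exists2 M : nat, (0 < M)%N &
    n%:R * ((@mesh R M `^ beta) ^+ 2 * @mesh R M ^+ d) <= 1 /\
    4 `^ (- (beta + 1)) * n%:R `^ (- ((beta + 1) / (2 * beta + d%:R))) <=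
      @mesh R M `^ beta * @mesh R M.
Proof.
move=> beta0 n0; set D := 2 * beta + d%:R.
have D0 : 0 < D by rewrite ltr_wpDr// mulr_gt0.
have n1 : 1 <= n%:R :> R by rewrite ler1n.
have nR : 0 < n%:R :> R by rewrite ltr0n.
pose N : R := n%:R `^ D^-1.
have N1 : 1 <= N by rewrite -[leLHS](powRr0 n%:R) ler_powR// invr_ge0 ltW.
have N0 : 0 < N by lra.
have ND : N `^ D = n%:R by rewrite -powRrM mulVf ?gt_eqF// powRr1// ltW.
exists (Num.truncn N).+1 => //; set h := @mesh R _.
have /andP[tN Nt] := truncn_itv (ltW N0).
have h0 : 0 < h by apply: mesh_gt0.
have hN : h <= N^-1.
  rewrite /h /mesh lef_pV2 ?posrE ?mulr_gt0//; apply: ltW (lt_le_trans Nt _).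
  by rewrite ler_peMl// ler1n.
have Nh : (4 * N)^-1 <= h.
  rewrite /h /mesh lef_pV2 ?posrE ?mulr_gt0//.
  by rewrite -natr1; lra.
split.
  have -> : (h `^ beta) ^+ 2 * h ^+ d = h `^ D.
    rewrite /D powRD; last by rewrite (gt_eqF h0) implybT.
    by rewrite (mulrC 2) powRrM !powR_mulrn ?powR_ge0// ltW.
  have : h `^ D <= N^-1 `^ D by rewrite ge0_ler_powR ?nnegrE ?invr_ge0// ltW.
  rewrite -[N^-1]powR_inv1 ?(ltW N0)// -powRrM mulN1r powRN ND => hD.
  apply: (le_trans (ler_wpM2l (ltW nR) hD)).
  by rewrite mulfV// gt_eqF.
have -> : h `^ beta * h = h `^ (beta + 1).
  rewrite powRD; last by rewrite (gt_eqF h0) implybT.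
  by rewrite powRr1// ltW.
have -> : n%:R `^ (- ((beta + 1) / D)) = N `^ (- (beta + 1)).
  by rewrite /N -powRrM; congr (_ `^ _); rewrite [RHS]mulrC mulNr.
rewrite -powRM ?ler0n ?(ltW N0)//.
rewrite -[- (beta + 1)]mulN1r powRrM powR_inv1 ?mulr_ge0 ?(ltW N0)//.
rewrite ge0_ler_powR ?nnegrE ?invr_ge0 ?mulr_ge0 ?(ltW N0) ?(ltW h0)//.
by rewrite addr_ge0// ltW.
Qed.

Lemma rate_cst_gt0 (R : realType) (d : nat) (beta C : R) : 1 <= C ->
  0 < @rate_cst R d beta C.
Proof.
move=> C1; rewrite divr_gt0//; last first.
  apply: mulr_gt0; last exact: exprn_gt0.
  by apply: mulr_gt0 => //; exact: lt_le_trans ltr01 (Hc_ge1 C1).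
apply: mulr_gt0; first exact: amplitude_gt0.
apply: mulr_gt0; first exact: gauss_min_gt0.
by rewrite !exprn_gt0// divr_gt0.
Qed.

Theorem theorem2 (R : realType) (d : nat) (beta K : R)
    (d_ge3 : (3 <= d)%N) (beta_gt0 : 0 < beta) (K_ge1 : 1 <= K) :
  exists2 c : R, 0 < c &
    forall n : nat, (1 <= n)%N ->
      ((c * n%:R `^ (- ((beta + 1) / (2 * beta + d%:R))))%:E
        <= minimax_risk R d beta K n)%E.
Proof.
(* The bump and its bound are fixed before [n], so the final constant does not depend on [n]. *)
have [phi [C [C1 phi0E dphi phiC phi_supp]]] := @exists_bump R (Num.truncn beta).
have c0 := rate_cst_gt0 d beta C1.
exists (rate_cst (d := d) beta C * 4 `^ (- (beta + 1))).
  by rewrite mulr_gt0// powR_gt0.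
move=> n n1; have [M M0 [nh hn]] := exists_mesh d beta_gt0 n1.
apply/ereal_infP => _ [phat _ <-].
have [P mP riskP] := hypercube_risk d_ge3 beta_gt0 K_ge1 C1 phi0E dphi phiC phi_supp
  phat n1 M0 nh.
apply: (@le_trans _ _ (risk phat P)); last by apply: ereal_sup_ubound; exists P.
apply: le_trans riskP; rewrite lee_fin -mulrA; apply: ler_wpM2l hn.
exact: ltW.
Qed.
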